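(* Let $n\ge3$ and for $\alpha\in(0,1)$ let $u_\alpha:\mathbb R^2\to\mathbb R^2$ be the non-linear Conti construction described in the context. Then the function $v_0:=\frac{d}{d\alpha}u_\alpha\big|_{\alpha=\frac12}:\mathbb R^2\to\mathbb R^2$ is a displacement vector field for a geometrically linear Conti construction, i.e. it is a piecewise affine, continuous vector field which has constant gradient on each of the triangles $T_1,\dots,T_{2n}$ (taken at $\alpha=\frac12$). The symmetrised gradients are given by $$e(\nabla v_0)|_{T_j}=E_j:=\frac{d}{d\alpha}\Bigl[e\bigl(U_j(\alpha)\bigr)\Bigr]\Big|_{\alpha=\frac12},\qquad j=1,\dots,2n,$$ the linearisations and symmetrisations of the matrices $U_1(\alpha),\dots,U_{2n}(\alpha)$. In the exterior of the polygon $\Omega_n^E$ and in the polygon $\Omega_n^I$ (at $\alpha=\frac12$), $\nabla v_0$ is a (constant) skew-symmetric matrix.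
   Context: $e(M)=\frac12(M+M^T)$. $\{e_1,e_2\}$ is the standard orthonormal basis of $\mathbb R^2$, $Q_s$ is the counterclockwise rotation by angle $\frac{2\pi}{n}s$, and $e^\perp=$ counterclockwise rotation of $e$ by $\pi/2$. For $\alpha\in(0,1)$ set $r_E=1$, $r_I=\frac{1}{\cos(\pi/n)}\bigl(\cos(\frac{\pi}{n}(1-2\alpha))-\sqrt{\sin(\frac{2\pi}{n}\alpha)\sin(\frac{2\pi}{n}(1-\alpha))}\bigr)$, $a=a(\alpha)=\sqrt{\sin(\frac{2\pi}{n}(1-\alpha))/\sin(\frac{2\pi}{n}\alpha)}$. Let $E_i^{pt}=Q_{i-1}e_1$ and $I_i=r_IQ_{i-1+\alpha}e_1$ ($i=1,\dots,n$; $E^{pt}_{n+1}=E^{pt}_1$, $I_0=I_n$) be the vertices of the outer and inner regular $n$-gons $\Omega_n^E$, $\Omega_n^I$ (convex hulls). $T_j$ ($1\le j\le2n$) is the open triangle with vertices $E^{pt}_{(j+1)/2},I_{(j-1)/2},I_{(j+1)/2}$ ($j$ odd) or $E^{pt}_{j/2},I_{j/2},E^{pt}_{1+j/2}$ ($j$ even). Let $e_{11}=\frac{I_1-E^{pt}_1}{|I_1-E^{pt}_1|}$, $P_0=e_{11}\otimes e_{11}-e_{11}^\perp\otimes e_{11}^\perp$, $\phi=\frac{(n-2)\pi}{2n}$, $U=a\,e_{11}\otimes e_{11}+a^{-1}e_{11}^\perp\otimes e_{11}^\perp+\frac{a^{-1}-a}{\tan\phi}e_{11}\otimes e_{11}^\perp$.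 Define $U_j(\alpha)=Q_{\frac{j-1}{2}}UQ_{\frac{j-1}{2}}^T$ for $j$ odd and $U_j(\alpha)=Q_{\frac{j-2}{2}}P_0UP_0Q_{\frac{j-2}{2}}^T$ for $j$ even. The non-linear Conti construction $u_\alpha\in W^{1,\infty}_{loc}(\mathbb R^2;\mathbb R^2)$ is the map with $u_\alpha(x)=x$ outside $\Omega_n^E$, $u_\alpha(x)=R_*x$ in $\Omega_n^I$ with $R_*=Q_{1-2\alpha}$, and $\nabla u_\alpha=R_E^TU_j(\alpha)$ on $T_j$, $j=1,\dots,2n$, for a suitable $R_E=R_E(\alpha)\in SO(2)$. (All of $r_I,a,I_i,T_j,e_{11},R_E$ depend on $\alpha$.) *)

(* Defs.v *)
From HB Require Import structures.
From mathcomp Require Import all_boot all_order all_algebra.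
From mathcomp Require Import all_classical all_reals all_analysis.
Import Order.TTheory GRing.Theory Num.Theory.
Import numFieldNormedType.Exports.

Set Implicit Arguments.
Unset Strict Implicit.
Unset Printing Implicit Defensive.

Local Open Scope classical_set_scope.
Local Open Scope ring_scope.

Section PlaneGeometry.
Context {R : realType}.
Implicit Types (x y : 'cV[R]_2) (M : 'M[R]_2) (A : set 'cV[R]_2)
  (f : 'cV[R]_2 -> 'cV[R]_2).

Definition sym_part M : 'M[R]_2 := 2^-1 *: (M + M^T).

Definition skew_mx M : Prop := M^T = - M.

Definition SO2 : set 'M[R]_2 := [set M | M *m M^T = 1%:M /\ \det M = 1].

Definition rotation (t : R) : 'M[R]_2 :=
  \matrix_(i, j) (if i == j then cos t
                  else if i == 0 then - sin t else sin t).

Definition perp x : 'cV[R]_2 := rotation (pi / 2) *m x.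

Definition tensor x y : 'M[R]_2 := x *m y^T.

(* The library norm on matrices is the sup norm. *)
Definition enorm x : R := Num.sqrt (\sum_i x i 0 ^+ 2).

Definition convex_hull m (p : 'I_m -> 'cV[R]_2) : set 'cV[R]_2 :=
  [set x | exists l : 'I_m -> R,
    [/\ forall i, 0 <= l i, \sum_i l i = 1 & x = \sum_i l i *: p i]].

Definition open_triangle (p q r : 'cV[R]_2) : set 'cV[R]_2 :=
  [set x | exists a b c : R,
    [/\ 0 < a, 0 < b, 0 < c, a + b + c = 1 &
        x = a *: p + b *: q + c *: r]].

(* (grad f x) i j is the j-th partial derivative of the i-th component. *)
Definition grad f x : 'M[R]_2 :=
  \matrix_(i, j) ('D_(delta_mx j 0) f x) i 0.

Definition gradient_on A f M : Prop :=
  forall x, A x -> differentiable f x /\ grad f x = M.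

Definition affine_on A f : Prop :=
  exists M (b : 'cV[R]_2), forall x, A x -> f x = M *m x + b.

Definition piecewise_affine (S : set (set 'cV[R]_2)) f : Prop :=
  [/\ finite_set S, \bigcup_(A in S) closure A = setT &
      forall A, S A -> affine_on (closure A) f].

Definition locally_lipschitz f : Prop :=
  forall x, exists2 A, nbhs x A & [lipschitz f y | y in A].

End PlaneGeometry.

Section ContiConstruction.
Context {R : realType}.
Variables (n : nat) (alpha : R).

Definition rotQ (s : R) : 'M[R]_2 := rotation (2 * pi / n%:R * s).

Definition inner_radius : R :=
  (cos (pi / n%:R))^-1 *
  (cos (pi / n%:R * (1 - 2 * alpha)) -
   Num.sqrt (sin (2 * pi / n%:R * alpha) *
             sin (2 * pi / n%:R * (1 - alpha)))).

Definition conti_a : R :=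
  Num.sqrt (sin (2 * pi / n%:R * (1 - alpha)) / sin (2 * pi / n%:R * alpha)).

Definition basis1 : 'cV[R]_2 := delta_mx 0 0.

(* Both families are n-periodic in i, so that the conventions
   E_(n+1) = E_1 and I_0 = I_n hold automatically. *)
Definition outer_vertex (i : nat) : 'cV[R]_2 := rotQ (i%:R - 1) *m basis1.
Definition inner_vertex (i : nat) : 'cV[R]_2 :=
  inner_radius *: (rotQ (i%:R - 1 + alpha) *m basis1).

Definition outer_polygon : set 'cV[R]_2 :=
  convex_hull (fun i : 'I_n => outer_vertex i.+1).
Definition inner_polygon : set 'cV[R]_2 :=
  convex_hull (fun i : 'I_n => inner_vertex i.+1).

(* Meaningful for 1 <= j <= 2 n. *)
Definition conti_triangle (j : nat) : set 'cV[R]_2 :=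
  if odd j then
    open_triangle (outer_vertex j.+1./2)
                  (inner_vertex j.-1./2) (inner_vertex j.+1./2)
  else
    open_triangle (outer_vertex j./2)
                  (inner_vertex j./2) (outer_vertex (j./2).+1).

Definition conti_e11 : 'cV[R]_2 :=
  (enorm (inner_vertex 1 - outer_vertex 1))^-1 *:
  (inner_vertex 1 - outer_vertex 1).

Definition conti_P0 : 'M[R]_2 :=
  tensor conti_e11 conti_e11 - tensor (perp conti_e11) (perp conti_e11).

Definition conti_phi : R := (n%:R - 2) * pi / (2 * n%:R).

Definition conti_U : 'M[R]_2 :=
  conti_a *: tensor conti_e11 conti_e11
  + conti_a^-1 *: tensor (perp conti_e11) (perp conti_e11)
  + ((conti_a^-1 - conti_a) / tan conti_phi) *: tensor conti_e11 (perp conti_e11).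

(* Meaningful for 1 <= j <= 2 n. *)
Definition conti_Uj (j : nat) : 'M[R]_2 :=
  if odd j then rotQ (j.-1./2)%:R *m conti_U *m (rotQ (j.-1./2)%:R)^T
  else rotQ (j.-2./2)%:R *m (conti_P0 *m conti_U *m conti_P0)
       *m (rotQ (j.-2./2)%:R)^T.

(* W^{1,oo}_loc maps are identified with their continuous representatives, the
   locally Lipschitz maps.  On the open triangles a constant weak gradient is
   the same as a constant classical one. *)
Definition nonlinear_conti (u : 'cV[R]_2 -> 'cV[R]_2) : Prop :=
  [/\ locally_lipschitz u,
      forall x, ~ outer_polygon x -> u x = x,
      forall x, inner_polygon x -> u x = rotQ (1 - 2 * alpha) *m x &
      exists2 RE : 'M[R]_2, SO2 RE &
        forall j, (1 <= j <= 2 * n)%N ->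
          gradient_on (conti_triangle j) u (RE^T *m conti_Uj j)].

Definition conti_pieces : set (set 'cV[R]_2) :=
  [set ~` outer_polygon; inner_polygon] `|`
  [set conti_triangle j | j in [set j | (1 <= j <= 2 * n)%N]].

Definition linear_conti_displacement (v : 'cV[R]_2 -> 'cV[R]_2) : Prop :=
  [/\ continuous v,
      piecewise_affine conti_pieces v &
      forall j, (1 <= j <= 2 * n)%N ->
        exists G : 'M[R]_2, gradient_on (conti_triangle j) v G].

End ContiConstruction.

Definition linearized_strain {R : realType} (n j : nat) : 'M[R]_2 :=
  derive1 (fun alpha : R => sym_part (conti_Uj n alpha j)) 2^-1.

(* Main.v *)
Require Import Defs.
From HB Require Import structures.
From mathcomp Require Import all_boot all_order all_algebra.
From mathcomp Require Import all_classical all_reals all_analysis.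
From mathcomp Require Import ring lra.
Import Order.TTheory GRing.Theory Num.Theory.
Import numFieldNormedType.Exports.
Local Open Scope classical_set_scope.
Local Open Scope ring_scope.
Set Implicit Arguments.
Unset Strict Implicit.
Unset Printing Implicit Defensive.

(** The map [u alpha] is affine on each closed triangle, so it is determined
    there by its values at the vertices: an outer vertex is fixed, and an inner
    vertex is rotated by the rotation that acts on the inner polygon.  At
    [alpha = 1/2] this rotation is the identity, hence so is [u (1/2)].
    Differentiating in [alpha], the velocity field is at rest at the outer
    vertices, it is the infinitesimal rotation [spin] on the inner polygon, and
    on a triangle it is the affine interpolation of these vertex velocities.

    The triangles move with [alpha], so that a fixed point may lie in different
    pieces for different values of [alpha].  This is dealt with by a uniform
    estimate: for [s] near [1/2] the map [u s - id] is Lipschitz with constant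
    [L * |s - 1/2|] ([displacement_lipschitz]).  Therefore the derivative at a
    point of a closed piece may be computed along the point with the same convex
    weights in the moving piece ([is_derive_moving_point]).  The same estimate
    makes the velocity field Lipschitz.  Two closed pieces that meet thus
    automatically give the same velocity on their intersection.

    The Lipschitz estimate rests on two facts.  A continuous selection of
    finitely many [L]-Lipschitz maps is [L]-Lipschitz ([lipschitz_selection]).
    And for [alpha] near [1/2] the exterior, the inner polygon and the closed
    triangles cover the plane ([conti_cover]): a point is put into the angular
    sector between two consecutive outer vertices by the edge normal on which
    it has the largest component, and the part of the sector inside the polygon
    is cut up by hand.

    For the strains, [u alpha] has on the [j]-th triangle the gradient
    [R^T *m U_j] with a rotation [R] that depends on [alpha].  The product
    [G^T *m G] of the gradient [G] is the one of [U_j], and both matrices are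
    the identity at [alpha = 1/2].  Since the derivative of [G^T *m G] at the
    identity is twice the symmetric part of the derivative of [G], the two
    symmetric parts agree ([sym_part_derive_congr]). *)

(** * Derivatives of matrix-valued curves *)

Lemma forall_ord2 (P : 'I_2 -> Prop) : P 0 -> P 1 -> forall i, P i.
Proof.
by move=> P0 P1 [[|[|//]] i]; [move: P0|move: P1]; congr P; exact: val_inj.
Qed.

Section DerivativeEstimates.
Context {R : realType}.
Implicit Types (V W : normedModType R) (t : R).

(** The quotient-free form of differentiability, which can be added up and
    compared without dividing by [s - t]. *)
Lemma is_derive1P V (f : R -> V) t (df : V) :
  is_derive t 1 f df <->
  forall e, 0 < e -> \forall s \near t,
    `|f s - f t - (s - t) *: df| <= e * `|s - t|.
Proof.
have quotE : (fun h : R => h^-1 *: ((f \o shift t) (h *: 1) - f t)) =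
             (fun h => h^-1 *: (f (h + t) - f t)).
  by apply/funext => h /=; rewrite [h%:A]mulr1.
have normE (h : R) : h != 0 ->
  `|f (t + h) - f t - h *: df| = `|h| * `|df - h^-1 *: (f (h + t) - f t)|.
  move=> hne; rewrite -normrZ scalerBr scalerA divff// scale1r distrC.
  by rewrite (addrC t).
split.
  move=> [fD fdf] e e0.
  have cf : (fun h => h^-1 *: (f (h + t) - f t)) @ 0^' --> df.
    by rewrite -fdf -quotE; exact: fD.
  move/cvgrPdist_le : cf => /(_ e e0) H.
  have {}H : \forall h \near (0 : R), h != 0 ->
      `|df - h^-1 *: (f (h + t) - f t)| <= e by exact: H.
  apply/nbhs0P; near=> h.
  rewrite (_ : t + h - t = h); last by ring.
  have [->|hne] := eqVneq h 0.
    by rewrite addr0 subrr scale0r subr0 !normr0 mulr0.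
  by rewrite normE// mulrC ler_wpM2r//; move: hne; near: h.
move=> H.
have cf : (fun h : R => h^-1 *: ((f \o shift t) (h *: 1) - f t)) @ 0^' --> df.
  rewrite quotE; apply/cvgrPdist_le => e e0.
  have {}H : \forall h \near (0 : R), h != 0 ->
      `|df - h^-1 *: (f (h + t) - f t)| <= e.
    have /nbhs0P := H e e0; apply: filterS => h.
    rewrite (_ : t + h - t = h); last by ring.
    by move=> + hne; rewrite normE// mulrC ler_pM2r ?normr_gt0.
  exact: H.
by split; [apply/cvg_ex; exists df|exact/cvg_lim].
Unshelve. all: by end_near. Qed.

Lemma is_derive_near_le V (f : R -> V) t df :
  is_derive t 1 f df ->
  \forall s \near t, `|f s - f t| <= (`|df| + 1) * `|s - t|.
Proof.
move/is_derive1P => /(_ 1 ltr01); apply: filterS => s H.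
rewrite -(subrK ((s - t) *: df) (f s - f t)).
by rewrite (le_trans (ler_normD _ _))// normrZ mulrDl addrC lerD// mulrC.
Qed.

Lemma is_derive_mxP m n (M : R -> 'M[R]_(m, n)) t D :
  is_derive t 1 M D <-> forall i j, is_derive t 1 (fun s => M s i j) (D i j).
Proof.
split=> [[dM <-] i j|H].
  by split; [move/derivable_mxP : dM => /(_ i j)|rewrite derive_mx// mxE].
have dM : derivable M t 1 by apply/derivable_mxP => i j; have [] := H i j.
split=> //; rewrite derive_mx//; apply/matrixP => i j; rewrite mxE.
by have [] := H i j.
Qed.

Lemma is_derive_mulmx m n p (A : R -> 'M[R]_(m, n)) (B : R -> 'M[R]_(n, p)) t
    dA dB :
  is_derive t 1 A dA -> is_derive t 1 B dB ->
  is_derive t 1 (fun s => A s *m B s) (dA *m B t + A t *m dB).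
Proof.
move=> /is_derive_mxP dAE /is_derive_mxP dBE; apply/is_derive_mxP => i j.
have H : is_derive t 1 (\sum_(k < n) (fun s => A s i k * B s k j))
   (\sum_(k < n) (A t i k *: dB k j + B t k j *: dA i k)).
  apply: is_derive_sum => k.
  exact: (@is_deriveM _ _ (fun s => A s i k) (fun s => B s k j)).
have -> : (fun s => (A s *m B s) i j) =
          \sum_(k < n) (fun s => A s i k * B s k j).
  by apply/funext => s; rewrite mxE fct_sumE.
apply: is_derive_eq H _; rewrite !mxE -big_split /=; apply: eq_bigr => k _.
by rewrite addrC; congr (_ + _); rewrite /GRing.scale /= mulrC.
Qed.

Lemma is_derive_trmx m n (A : R -> 'M[R]_(m, n)) t dA :
  is_derive t 1 A dA -> is_derive t 1 (fun s => (A s)^T) dA^T.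
Proof.
move=> /is_derive_mxP dAE; apply/is_derive_mxP => i j.
rewrite mxE (_ : (fun s => _) = (fun s => A s j i))//.
by apply/funext => s; rewrite mxE.
Qed.

Lemma normr_mx_ge m n (A : 'M[R]_(m, n)) i j : `|A i j| <= `|A|.
Proof. by rewrite [leRHS]/Num.norm /= mx_normrE (le_bigmax _ _ (i, j)). Qed.

Lemma normr_mx_le m n (A : 'M[R]_(m, n)) e :
  0 <= e -> (forall i j, `|A i j| <= e) -> `|A| <= e.
Proof.
move=> e0 H; rewrite [leLHS]/Num.norm /= mx_normrE.
by apply/bigmax_leP; split=> // -[i j] _.
Qed.

Lemma normr_mulmx_le m n p (A : 'M[R]_(m, n)) (B : 'M[R]_(n, p)) :
  `|A *m B| <= n%:R * `|A| * `|B|.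
Proof.
apply: normr_mx_le => [|i j]; first by rewrite !mulr_ge0.
rewrite mxE (le_trans (ler_norm_sum _ _ _))//.
rewrite -mulrA -[X in X%:R]card_ord mulr_natl -sumr_const ler_sum// => k _.
by rewrite normrM ler_pM// normr_mx_ge.
Qed.

(** Since [E] vanishes at [t], replacing [B] by [B t] in [A = E *m B^-1] changes
    [A] only to second order; the derivative is therefore the one obtained with
    [B] frozen at [t]. *)
Lemma is_derive_mulmx_cancel m n (A E : R -> 'M[R]_(m, n)) (B : R -> 'M[R]_n)
    t dE :
  (\forall s \near t, A s *m B s = E s) ->
  is_derive t 1 E dE -> E t = 0 -> {for t, continuous B} -> B t \in unitmx ->
  A t = 0 /\ is_derive t 1 A (dE *m invmx (B t)).
Proof.
move=> AB dEP E0 cB uB; set C := invmx (B t).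
have A0 : A t = 0.
  by rewrite -(mulmxK uB (A t)) (nbhs_singleton AB) E0 mul0mx.
split=> //; pose K := 2 * n%:R * `|C| * (`|dE| + 1).
have nC0 : 0 <= n%:R * `|C| by rewrite mulr_ge0.
have K0 : 0 <= K by rewrite /K -!mulrA mulr_ge0// mulrA mulr_ge0// addr_ge0.
(* With [C] the inverse of [B t], [A = E *m C - A *m N] where [N] tends to [0];
   the last term is first absorbed to bound [A] and then negligible. *)
pose N s := B s *m C - 1%:M.
have AE s : A s *m B s = E s -> A s = E s *m C - A s *m N s.
  move=> <-; rewrite /N mulmxBr mulmx1 mulmxA opprB addrCA subrr.
  by rewrite addr0.
have cN r : 0 < r -> \forall s \near t, n%:R * `|N s| <= r.
  move=> r0; pose r' := r / ((n%:R * (n%:R * `|C|)) + 1).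
  have r'0 : 0 < r' by rewrite divr_gt0// ltr_wpDl// mulr_ge0.
  move/cvgrPdist_le : cB => /(_ r' r'0); apply: filterS => s Hs.
  have -> : N s = (B s - B t) *m C by rewrite /N mulmxBl mulmxV.
  rewrite -normrN opprB in Hs.
  rewrite (le_trans (ler_wpM2l _ (normr_mulmx_le _ _)))//.
  rewrite [leLHS](_ : _ = `|B s - B t| * (n%:R * (n%:R * `|C|))); last by ring.
  have D0 : 0 <= n%:R * (n%:R * `|C|) by rewrite mulr_ge0.
  rewrite (le_trans (ler_wpM2r D0 Hs))// /r' -mulrA ler_piMr ?(ltW r0)//.
  by rewrite mulrC ler_pdivrMr ?mul1r ?lerDl// ltr_wpDl.
have Abd : \forall s \near t, `|A s| <= K * `|s - t|.
  have := is_derive_near_le dEP; rewrite E0 => dEn.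
  have h2 : 0 < 2^-1 :> R by rewrite invr_gt0.
  near=> s.
  have Ns : n%:R * `|N s| <= 2^-1 by near: s; exact: cN.
  have Es : `|E s| <= (`|dE| + 1) * `|s - t|.
    by rewrite -[E s]subr0; near: s.
  have ABs : A s *m B s = E s by near: s.
  have : `|A s| <= n%:R * `|E s| * `|C| + 2^-1 * `|A s|.
    rewrite {1}(AE _ ABs) (le_trans (ler_normB _ _))// lerD ?normr_mulmx_le//.
    rewrite (le_trans (normr_mulmx_le _ _))// mulrAC ler_wpM2r//.
  move=> H; have : `|A s| <= 2 * (n%:R * `|E s| * `|C|) by lra.
  move=> /le_trans; apply; rewrite /K.
  rewrite [leLHS](_ : _ = 2 * n%:R * `|C| * `|E s|); last by ring.
  by rewrite -[leRHS]mulrA ler_wpM2l// -mulrA mulr_ge0.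
have dEC : is_derive t 1 (fun s => E s *m C) (dE *m C).
  have dC := is_derive_cst C t (1 : R).
  by apply: is_derive_eq (is_derive_mulmx dEP dC) _; rewrite mulmx0 addr0.
apply/is_derive1P => e e0; move/is_derive1P : dEC => dEC.
have e20 : 0 < e / 2 by rewrite divr_gt0.
pose r := e / 2 / (K + 1).
have r0 : 0 < r by rewrite divr_gt0// ltr_wpDl.
near=> s.
have ABs : A s *m B s = E s by near: s.
have Ns : n%:R * `|N s| <= r by near: s; exact: cN.
have As : `|A s| <= K * `|s - t| by near: s.
have Ds : `|E s *m C - E t *m C - (s - t) *: (dE *m C)| <= e / 2 * `|s - t|.
  by near: s; exact: dEC.
rewrite A0 subr0 {1}(AE _ ABs) addrAC (le_trans (ler_normB _ _))//.
rewrite [e in leRHS](splitr e) mulrDl lerD//.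
  by move: Ds; rewrite E0 mul0mx subr0.
rewrite (le_trans (normr_mulmx_le _ _))// mulrAC.
apply: (@le_trans _ _ (r * (K * `|s - t|))); first by rewrite ler_pM// mulr_ge0.
rewrite mulrA ler_wpM2r// /r -mulrA ler_piMr ?(ltW e20)// mulrC.
by rewrite ler_pdivrMr ?mul1r ?lerDl// ltr_wpDl.
Unshelve. all: by end_near. Qed.

Lemma is_derive_norm_le (V : normedModType R) (f : R -> V) (t : R) df (K : R) :
  (\forall s \near t, `|f s - f t| <= K * `|s - t|) ->
  is_derive t 1 f df -> `|df| <= K.
Proof.
move=> fK /is_derive1P fD; apply/ler_addgt0Pr => e e0.
have [/= d d0 dH] := (nbhs_ballP _ _).1 (filterI fK (fD e e0)).
have d20 : 0 < d / 2 by rewrite divr_gt0.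
have [] : `|f (t + d / 2) - f t| <= K * `|t + d / 2 - t| /\
    `|f (t + d / 2) - f t - (t + d / 2 - t) *: df| <= e * `|t + d / 2 - t|.
  apply: dH; rewrite /ball /= opprD addrA subrr sub0r normrN gtr0_norm//; lra.
have -> : t + d / 2 - t = d / 2 by rewrite addrC addKr.
move=> h1 h2; rewrite -(ler_pM2r d20).
have -> : `|df| * (d / 2) = `|(d / 2) *: df| by rewrite normrZ gtr0_norm// mulrC.
rewrite (gtr0_norm d20) in h1 h2.
rewrite mulrDl -[X in `|X|](subKr (f (t + d / 2) - f t)).
by rewrite (le_trans (ler_normB _ _))// lerD.
Qed.

Lemma is_derive_zero_near_le (V : normedModType R) (f : R -> V) (t : R) df :
  f t = 0 -> is_derive t 1 f df ->
  exists K : R, 0 <= K /\ \forall s \near t, `|f s| <= K * `|s - t|.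
Proof.
move=> f0 /is_derive_near_le; rewrite f0 => H.
exists (`|df| + 1); split; first by rewrite addr_ge0.
by apply: filterS H => s; rewrite subr0.
Qed.

Lemma is_derive_mulmx_zero m n p (A : R -> 'M[R]_(m, n))
    (B : R -> 'M[R]_(n, p)) (t : R) dA :
  A t = 0 -> is_derive t 1 A dA -> derivable B t 1 ->
  is_derive t 1 (fun s => A s *m B s) (dA *m B t).
Proof.
move=> A0 AD /derivableP BD; apply: is_derive_eq (is_derive_mulmx AD BD) _.
by rewrite A0 mul0mx addr0.
Qed.

Lemma derivable_comp1 (f g : R -> R) (a : R) :
  derivable f (g a) 1 -> derivable g a 1 -> derivable (fun s => f (g s)) a 1.
Proof.
move=> /derivable1_diffP df /derivable1_diffP dg.
by apply/derivable1_diffP; exact: (@differentiable_comp _ _ _ _ g f).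
Qed.

Lemma derivable_mulmx m n p (A : R -> 'M[R]_(m, n)) (B : R -> 'M[R]_(n, p)) a :
  derivable A a 1 -> derivable B a 1 -> derivable (fun s => A s *m B s) a 1.
Proof.
by move=> /derivableP dA /derivableP dB; have [] := is_derive_mulmx dA dB.
Qed.

Lemma derivable_scalemx m n (f : R -> R) (A : R -> 'M[R]_(m, n)) a :
  derivable f a 1 -> derivable A a 1 -> derivable (fun s => f s *: A s) a 1.
Proof.
move=> df /derivable_mxP dA; apply/derivable_mxP => i j.
rewrite (_ : (fun s => _) = f * (fun s => A s i j)); last first.
  by apply/funext => s; rewrite mxE.
exact: derivableM.
Qed.

Lemma derivable_trmx m n (A : R -> 'M[R]_(m, n)) a :
  derivable A a 1 -> derivable (fun s => (A s)^T) a 1.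
Proof. by move=> /derivableP dA; have [] := is_derive_trmx dA. Qed.

Lemma derivable_continuous1 (V : normedModType R) (f : R -> V) a :
  derivable f a 1 -> {for a, continuous f}.
Proof. by move=> /derivable1_diffP /differentiable_continuous. Qed.

Lemma derivable_affine (b c a : R) : derivable (fun s => b + c * s) a 1.
Proof.
apply: derivableD; first exact: derivable_cst.
by apply: derivableM; [exact: derivable_cst|exact: derivable_id].
Qed.

Lemma derivable_sin_affine (b c a : R) : derivable (fun s => sin (b + c * s)) a 1.
Proof. by apply: derivable_comp1; [exact: derivable_sin|exact: derivable_affine]. Qed.

Lemma derivable_cos_affine (b c a : R) : derivable (fun s => cos (b + c * s)) a 1.
Proof. by apply: derivable_comp1; [exact: derivable_cos|exact: derivable_affine]. Qed.

Lemma derivable_sqrt_comp (f : R -> R) a :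
  0 < f a -> derivable f a 1 -> derivable (fun s => Num.sqrt (f s)) a 1.
Proof.
move=> fa0; apply: derivable_comp1.
by have [] := is_derive1_sqrt fa0.
Qed.

Lemma derivable_rotation_affine (b c a : R) :
  derivable (fun s => rotation (b + c * s)) a 1.
Proof.
apply/derivable_mxP; apply: forall_ord2; apply: forall_ord2.
- rewrite (_ : (fun s => _) = (fun s => cos (b + c * s))).
    exact: derivable_cos_affine.
  by apply/funext => s; rewrite mxE.
- rewrite (_ : (fun s => _) = - (fun s => sin (b + c * s))).
    by apply: derivableN; exact: derivable_sin_affine.
  by apply/funext => s; rewrite mxE.
- rewrite (_ : (fun s => _) = (fun s => sin (b + c * s))).
    exact: derivable_sin_affine.
  by apply/funext => s; rewrite mxE.
- rewrite (_ : (fun s => _) = (fun s => cos (b + c * s))).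
    exact: derivable_cos_affine.
  by apply/funext => s; rewrite mxE.
Qed.

Lemma derivable_sym_part (F : R -> 'M[R]_2) (t : R) :
  derivable F t 1 -> derivable (fun s => sym_part (F s)) t 1.
Proof.
move=> dF; apply: derivable_scalemx; first exact: derivable_cst.
exact: (derivableD dF (derivable_trmx dF)).
Qed.

Lemma derive1_sym_part (F : R -> 'M[R]_2) (t : R) dF :
  is_derive t 1 F dF -> derive1 (fun s => sym_part (F s)) t = sym_part dF.
Proof.
move=> FD; rewrite derive1E.
have D : is_derive t 1 (2^-1 \*: (F + (fun s => (F s)^T))) (2^-1 *: (dF + dF^T)).
  exact: (is_deriveZ _ (is_deriveD FD (is_derive_trmx FD))).
by case: D.
Qed.

(** Curves with equal right Cauchy-Green tensors [F^T *m F], such as curves that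
    differ by a rotation on the left, have the same linearised strain: at the
    identity the derivative of [F^T *m F] is [dF^T + dF]. *)
Lemma sym_part_derive_congr (F G : R -> 'M[R]_2) (t : R) dF dG :
  F t = 1%:M -> G t = 1%:M -> is_derive t 1 F dF -> is_derive t 1 G dG ->
  (\forall s \near t, (F s)^T *m F s = (G s)^T *m G s) ->
  sym_part dF = sym_part dG.
Proof.
move=> F1 G1 FD GD FG.
have prod (H : R -> 'M[R]_2) dH : H t = 1%:M -> is_derive t 1 H dH ->
    is_derive t 1 (fun s => (H s)^T *m H s) (dH^T + dH).
  move=> H1 HD; apply: is_derive_eq (is_derive_mulmx (is_derive_trmx HD) HD) _.
  by rewrite H1 trmx1 mulmx1 mul1mx.
have [_ EF] := prod F dF F1 FD; have [_ EG] := prod G dG G1 GD.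
rewrite /sym_part addrC -EF [dG + _]addrC -EG; congr (_ *: _).
by apply: near_eq_derive => //; rewrite oner_neq0.
Qed.

End DerivativeEstimates.

(** * Lipschitz maps glued from finitely many pieces *)

Section LipschitzGluing.
Context {R : realType}.
Implicit Types (V W : normedModType R).

(** Along the segment from [x] to [y], the last parameter up to which the bound
    from [x] holds can be no smaller than [1]: the local bound at that parameter
    would extend it. *)
Lemma lipschitz_of_local V W (f : V -> W) (L : R) :
  (forall x, \forall y \near x, `|f y - f x| <= L * `|y - x|) ->
  forall x y, `|f y - f x| <= L * `|y - x|.
Proof.
move=> Hloc x y; pose v := y - x; pose g (t : R) := f (x + t *: v).
have gloc (t : R) : \forall s \near t, `|g s - g t| <= L * (`|s - t| * `|v|).
  have c : (fun s : R => x + s *: v) @ t --> x + t *: v.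
    apply: cvgD; first exact: cvg_cst.
    exact: scalel_continuous.
  have : \forall s \near t, `|f (x + s *: v) - f (x + t *: v)| <=
      L * `|x + s *: v - (x + t *: v)| by exact: c _ (Hloc (x + t *: v)).
  apply: filterS => s /=.
  by rewrite opprD addrACA subrr add0r -scalerBl normrZ.
pose S : set R := [set t | 0 <= t <= 1 /\ `|g t - g 0| <= L * (t * `|v|)].
have S0 : S 0 by split; rewrite ?lexx ?ler01// subrr normr0 mul0r mulr0.
have hS : has_sup S by split; [exists 0|exists 1 => t [] /andP[]].
pose T := sup S.
have T0 : 0 <= T by apply: ub_le_sup => //; case: hS.
have T1 : T <= 1 by apply: ge_sup => [|t [] /andP[]//]; exists 0.
have /nbhs_ballP[/= d d0 HT] := gloc T.
have [s Ss sT] := sup_adherent d0 hS.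
have leT : s <= T by apply: ub_le_sup => //; case: hS.
have Hs : `|g T - g s| <= L * ((T - s) * `|v|).
  rewrite distrC -{1}(ger0_norm (x := T - s)) ?subr_ge0// (distrC T).
  by apply: HT; rewrite /ball /= ger0_norm ?subr_ge0//; move: sT; rewrite -/T; lra.
have PT : `|g T - g 0| <= L * (T * `|v|).
  rewrite -(subrKA (g s)) (le_trans (ler_normD _ _))//.
  rewrite (le_trans (lerD Hs Ss.2))// -mulrDr -mulrDl subrK//.
suff T1E : T = 1.
  move: PT; rewrite T1E /g scale1r scale0r addr0 mul1r /v.
  by rewrite (addrC x) subrK.
apply/eqP; rewrite eq_le T1 leNgt; apply/negP => Tlt.
pose r := Num.min (d / 2) (1 - T).
have [r0 rd r1] : [/\ 0 < r, r < d & r <= 1 - T].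
  by rewrite /r; case: (leP (d / 2) (1 - T)) => ?; split; lra.
suff : S (T + r).
  move=> /(ub_le_sup _) => /(_ (proj2 hS)); rewrite -/T.
  by rewrite -subr_ge0 opprD addrA subrr add0r oppr_ge0 leNgt r0.
split; first by rewrite addr_ge0 ?(ltW r0)//=; lra.
rewrite -(subrKA (g T)) (le_trans (ler_normD _ _))//.
rewrite mulrDl addrC mulrDr lerD//.
have := HT (T + r); rewrite /ball /= opprD addrA subrr sub0r normrN.
by rewrite [T + r]addrC addrK ger0_norm ?(ltW r0)//; apply.
Qed.

(** Near a point [f] selects only among the maps that agree with it at the
    point, by continuity; each of them gives the local bound there. *)
Lemma lipschitz_selection V W (I : finType) (f : V -> W) (g : I -> V -> W)
    (L : R) :
  continuous f -> (forall i x y, `|g i y - g i x| <= L * `|y - x|) ->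
  (forall x, exists i, f x = g i x) ->
  forall x y, `|f y - f x| <= L * `|y - x|.
Proof.
move=> cf gL fg; apply: lipschitz_of_local => x.
have act : \forall y \near x, forall i, g i x != f x -> g i y != f y.
  apply: filter_forall => i.
  have [gfx|ne] := eqVneq (g i x) (f x); first exact: nearW.
  have e0 : 0 < `|g i x - f x| by rewrite normr_gt0 subr_eq0.
  have e2 : 0 < `|g i x - f x| / 2 by rewrite divr_gt0.
  have L1 : 0 < `|L| + 1 by rewrite ltr_wpDl.
  near=> y => _; apply/eqP => gfy.
  have fy : `|f x - f y| < `|g i x - f x| / 2.
    by near: y; exact: (@cvgr_dist_lt _ _ _ _ _ _ _ (cf x)).
  have gy : `|g i y - g i x| < `|g i x - f x| / 2.
    rewrite (le_lt_trans (gL _ _ _))//.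
    apply: (@le_lt_trans _ _ ((`|L| + 1) * `|y - x|)).
      by rewrite ler_wpM2r// (le_trans (ler_norm _))// lerDl.
    rewrite mulrC -ltr_pdivlMr// distrC.
    near: y; apply: cvgr_dist_lt; first exact: cvg_id.
    by rewrite divr_gt0.
  have : `|g i x - f x| < `|g i x - f x|.
    rewrite [ltRHS]splitr -[X in `|X| < _](subrKA (g i y)).
    rewrite (le_lt_trans (ler_normD _ _))// ltrD//; first by rewrite distrC.
    by rewrite gfy distrC.
  by rewrite ltxx.
near=> y.
have [i fgy] := fg y.
have -> : f x = g i x.
  apply/esym/eqP; apply: contraTT isT => ne.
  have : g i y != f y by move: (i) ne; near: y.
  by rewrite fgy eqxx.
by rewrite fgy.
Unshelve. all: by end_near. Qed.

(** The time derivative of the displacement [u s - id] at a fixed point may be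
    computed along any curve through that point: the displacements at the point
    and on the curve at time [s] differ by at most [L * `|s - t|] times the
    distance to the curve, which is of higher order in [s - t]. *)
Lemma is_derive_moving_point V (u : R -> V -> V) (t : R) (y : R -> V) (L : R) D :
  (\forall s \near t, forall p q,
     `|(u s p - p) - (u s q - q)| <= L * `|s - t| * `|p - q|) ->
  {for t, continuous y} ->
  is_derive t 1 (fun s => u s (y s) - y s) D ->
  is_derive t 1 (fun s => u s (y t)) D.
Proof.
move=> uL cy dD; set x := y t.
pose r s := (u s x - x) - (u s (y s) - y s).
have dr : is_derive t 1 r 0.
  apply/is_derive1P => e e0.
  have L1 : 0 < `|L| + 1 by rewrite ltr_wpDl.
  near=> s.
  rewrite scaler0 subr0 {2}/r subrr subr0 /r.
  have H : `|(u s x - x) - (u s (y s) - y s)| <= L * `|s - t| * `|x - y s|.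
    by move: {+}x (y s); near: s.
  rewrite (le_trans H)// mulrAC ler_wpM2r//.
  apply: (@le_trans _ _ ((`|L| + 1) * `|x - y s|)).
    by rewrite ler_wpM2r// (le_trans (ler_norm _))// lerDl.
  rewrite mulrC -ler_pdivlMr//.
  near: s; apply: (@cvgr_dist_le _ _ _ _ _ _ _ cy).
  by rewrite divr_gt0.
have dE : (fun s => u s x) = r + (fun s => u s (y s) - y s) + cst x.
  by apply/funext => s; rewrite /r !fctE /= subrK subrK.
rewrite dE; apply: (is_derive_eq (is_deriveD (is_deriveD dr dD) _)).
by rewrite add0r addr0.
Unshelve. all: by end_near. Qed.

End LipschitzGluing.

(** * Affine maps and triangles in the plane *)

Lemma diff_near_affine {R : numFieldType} (V W : normedModType R) (f : V -> W)
    (df : {linear V -> W}) (x : V) :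
  continuous df -> (\forall h \near 0, f (x + h) = f x + df h) ->
  differentiable f x /\ 'd f x = df :> (V -> W).
Proof.
move=> cdf fE.
have dE : f \o shift x = cst (f x) + df +o_ 0 id.
  apply/eqaddoP => e e0; apply: filterS fE => h fE.
  rewrite !fctE /= (addrC h) fE subrr normr0.
  by rewrite mulr_ge0// ltW.
have ddE := diff_unique cdf dE.
by split=> //; apply/diff_locallyP; rewrite ddE.
Qed.

Section AffineMaps.
Context {R : realType}.
Implicit Types (p q r x y v w : 'cV[R]_2) (M : 'M[R]_2) (A : set 'cV[R]_2)
  (f : 'cV[R]_2 -> 'cV[R]_2).

Lemma vec2P x y : x 0 0 = y 0 0 -> x 1 0 = y 1 0 -> x = y.
Proof.
by move=> e0 e1; apply/colP; apply: forall_ord2.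
Qed.

Lemma mulmx2E m (M : 'M[R]_(m, 2)) n (N : 'M[R]_(2, n)) i j :
  (M *m N) i j = M i 0 * N 0 j + M i 1 * N 1 j.
Proof.
rewrite mxE !big_ord_recl big_ord0 addr0; congr (_ * _ + M _ _ * N _ _);
  exact: val_inj.
Qed.

Definition frame v w : 'M[R]_2 := \matrix_(i, j) (if j == 0 then v i 0 else w i 0).

Lemma mul_frame M v w : M *m frame v w = frame (M *m v) (M *m w).
Proof.
apply/matrixP => i; apply: forall_ord2;
  by rewrite [LHS]mulmx2E [RHS]mxE /= [RHS]mulmx2E !mxE.
Qed.

Lemma frame_mul v w x : frame v w *m x = x 0 0 *: v + x 1 0 *: w.
Proof. by apply: vec2P; rewrite mulmx2E !mxE /= ![_ * x _ _]mulrC. Qed.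

Lemma det_frame v w : \det (frame v w) = v 0 0 * w 1 0 - v 1 0 * w 0 0.
Proof. 
rewrite (expand_det_row _ 0) !big_ord_recl big_ord0 /cofactor !det_mx11 !mxE /=.
rewrite expr0 expr1 (_ : lift 0 0 = 1); last exact: val_inj.
by ring.
Qed.

Lemma derive_grad f x v : differentiable f x -> 'D_v f x = grad f x *m v.
Proof.
move=> df; rewrite deriveE//.
have -> : v = v 0 0 *: delta_mx 0 0 + v 1 0 *: delta_mx 1 0.
  by apply: vec2P; rewrite !mxE /= !(mulr1, mulr0, addr0, add0r).
rewrite linearD !linearZ /= mulmxDr -!scalemxAr.
congr (_ *: _ + _ *: _).
  by apply: vec2P; rewrite mulmx2E !mxE !deriveE//= !(mulr1, mulr0, addr0, add0r).
by apply: vec2P; rewrite mulmx2E !mxE !deriveE//= !(mulr1, mulr0, addr0, add0r).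
Qed.

Lemma mulmx_continuous M : continuous (fun x => M *m x).
Proof.
move=> x; have FF : Filter (nbhs x) := nbhs_filter x.
apply/(@cvgrPdist_le _ _ _ (nbhs x)) => e e0.
have K0 : 0 < 2%:R * `|M| + 1 by rewrite ltr_wpDl// mulr_ge0.
have /cvgrPdist_le := @cvg_id _ (nbhs x).
move=> /(_ (e / (2%:R * `|M| + 1))) /(_ (divr_gt0 e0 K0)); apply: filterS => y Hy.
rewrite -mulmxBr (le_trans (normr_mulmx_le _ _))//.
apply: (@le_trans _ _ ((2%:R * `|M| + 1) * `|x - y|)).
  by rewrite ler_wpM2r// lerDl.
by rewrite mulrC -ler_pdivlMr.
Qed.

Lemma gradient_on_affine A f M b :
  open A -> (forall x, A x -> f x = M *m x + b) -> gradient_on A f M.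
Proof.
move=> oA fE x Ax.
have nA : nbhs x A by exact: open_nbhs_nbhs.
have [||df ddE] := @diff_near_affine _ _ _ f (mulmx M) x.
- exact: mulmx_continuous.
- have /nbhs0P := nA; apply: filterS => h Ah.
  by rewrite !fE// mulmxDr addrAC.
split=> //; apply/matrixP => i j; rewrite mxE deriveE// ddE /= mulmx2E !mxE.
by move: j; apply: forall_ord2; rewrite /= !(mulr1, mulr0, addr0, add0r).
Qed.

(** On a convex set, by the mean value theorem for each component along the
    segment. *)
Lemma affine_of_gradient A f M :
  (forall x y (t : R), A x -> A y -> 0 <= t <= 1 -> A (x + t *: (y - x))) ->
  gradient_on A f M ->
  forall x y, A x -> A y -> f y - f x = M *m (y - x).
Proof.
move=> convA gf x y Ax Ay; pose v := y - x.
pose g (t : R) := f (x + t *: v).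
have dg (t : R) : 0 <= t <= 1 -> is_derive t 1 g (M *m v).
  move=> t01; have [df gradf] := gf _ (convA _ _ _ Ax Ay t01).
  have dv : derivable f (x + t *: v) v by exact: diff_derivable.
  have E : (fun h : R => h^-1 *: ((g \o shift t) (h *: 1) - g t)) =
    (fun h => h^-1 *: ((f \o shift (x + t *: v)) (h *: v) - f (x + t *: v))).
    apply/funext => h; rewrite /g /= [h%:A]mulr1.
    by rewrite scalerDl addrCA.
  split; first by rewrite /derivable E.
  by rewrite /derive E -[LHS]/('D_v f (x + t *: v)) derive_grad// gradf.
apply/matrixP => i j; rewrite (ord1 j) {j}.
have dgi (t : R) : 0 <= t <= 1 -> is_derive t 1 (fun s => g s i 0) ((M *m v) i 0).
  by move=> /dg /is_derive_mxP; apply.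
have [||c _] := @MVT R (fun s => g s i 0) (fun=> (M *m v) i 0) 0 1 ltr01.
- by move=> t; rewrite in_itv /= => /andP[? ?]; apply: dgi; rewrite !ltW.
- apply: derivable_within_continuous => t; rewrite in_itv /= => t01.
  by have [] := dgi _ t01.
by rewrite /g scale1r scale0r addr0 /v [x + _]addrC subrK subr0 mulr1 !mxE.
Qed.

Lemma affine_closure A f M b : continuous f ->
  (forall x, A x -> f x = M *m x + b) ->
  forall x, closure A x -> f x = M *m x + b.
Proof.
move=> cf fE x clx; apply/eqP; rewrite -subr_eq0; apply: contraTT isT => ne.
have e0 : 0 < `|f x - (M *m x + b)| by rewrite normr_gt0.
have cg : {for x, continuous (fun y => f y - (M *m y + b))}.
  apply: continuousB; first exact: cf.
  apply: continuousD; first exact: mulmx_continuous.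
  exact: cst_continuous.
have /clx [y [Ay]] : \forall y \near x,
  `|(f x - (M *m x + b)) - (f y - (M *m y + b))| < `|f x - (M *m x + b)|.
  exact: (@cvgr_dist_lt _ _ _ _ _ _ _ cg).
by rewrite /= (fE _ Ay) subrr subr0 ltxx.
Qed.

Lemma locally_lipschitz_continuous f : locally_lipschitz f -> continuous f.
Proof.
move=> lf x; have [A nA Alip] := lf x.
have [K [K0 HK]] : exists K : R, 0 < K /\
    forall y z, A y -> A z -> `|f y - f z| <= K * `|y - z|.
  near (pinfty_nbhs R) => K; exists K; split=> //.
  move=> y z Ay Az; suff : K.-lipschitz_A f by move/(_ (y, z)); apply.
  by near: K.
apply/(@cvgrPdist_le _ _ _ (nbhs x)) => e e0.
have Ax : A x by exact: nbhs_singleton.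
have /cvgrPdist_le := @cvg_id _ (nbhs x).
move=> /(_ (e / K)) /(_ (divr_gt0 e0 K0)) Hx.
apply: filterS2 nA Hx => y Ay Hy.
by rewrite (le_trans (HK x y _ _))//= mulrC -ler_pdivlMr.
Unshelve. all: by end_near. Qed.

Lemma is_derive_frame (v w : R -> 'cV[R]_2) (t : R) dv dw :
  is_derive t 1 v dv -> is_derive t 1 w dw ->
  is_derive t 1 (fun s => frame (v s) (w s)) (frame dv dw).
Proof.
move=> /is_derive_mxP Dv /is_derive_mxP Dw; apply/is_derive_mxP => i.
apply: forall_ord2; rewrite mxE /=.
  by rewrite (_ : (fun s => _) = (fun s => v s i 0))//; apply/funext => s; rewrite mxE.
by rewrite (_ : (fun s => _) = (fun s => w s i 0))//; apply/funext => s; rewrite mxE.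
Qed.

Lemma frame0 : frame (0 : 'cV[R]_2) 0 = 0.
Proof. by apply/matrixP => i j; rewrite !mxE; case: ifP. Qed.

End AffineMaps.

Section Triangles.
Context {R : realType}.
Implicit Types (p q r x y v w : 'cV[R]_2) (M : 'M[R]_2) (A : set 'cV[R]_2)
  (f : 'cV[R]_2 -> 'cV[R]_2).

Definition closed_triangle p q r : set 'cV[R]_2 :=
  [set x | exists a b c : R, [/\ 0 <= a, 0 <= b, 0 <= c, a + b + c = 1 &
    x = a *: p + b *: q + c *: r]].

(** Moving a little towards the barycentre makes all weights
    positive. *)
Lemma closed_triangle_closure p q r :
  closed_triangle p q r `<=` closure (open_triangle p q r).
Proof.
move=> x [a [b [c [a0 b0 c0 abc xE]]]] B nB.
pose y (t : R) := x + t *: (3^-1 *: (p + q + r) - x).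
have cy : {for 0, continuous y}.
  apply: continuousD; first exact: cst_continuous.
  exact: scalel_continuous.
have nyB : \forall t \near (0 : R), B (y t).
  by apply: cy; rewrite /y scale0r addr0.
have [/= d d0 dB] := (nbhs_ballP _ _).1 nyB.
have [t [t0 td t1]] : exists t : R, [/\ 0 < t, t < d & t < 1].
  exists (Num.min (d / 2) (1 / 2)).
  by case: (leP (d / 2) (1 / 2)) => ?; split; lra.
exists (y t); split; last by apply: dB; rewrite /ball /= sub0r normrN gtr0_norm.
have pos (u : R) : 0 <= u -> 0 < u + t * (3^-1 - u).
  by move=> u0; nra.
exists (a + t * (3^-1 - a)), (b + t * (3^-1 - b)), (c + t * (3^-1 - c)).
split; rewrite ?pos//.
  by have -> : a = 1 - b - c; [rewrite -abc; ring|field].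
by rewrite /y xE; apply: vec2P; rewrite !mxE; ring.
Qed.

Lemma open_triangle_convex p q r x y (t : R) :
  open_triangle p q r x -> open_triangle p q r y -> 0 <= t <= 1 ->
  open_triangle p q r (x + t *: (y - x)).
Proof.
move=> [a [b [c [a0 b0 c0 abc ->]]]] [a' [b' [c' [a'0 b'0 c'0 abc' ->]]]].
move=> /andP[t0 t1].
have pos (u u' : R) : 0 < u -> 0 < u' -> 0 < u + t * (u' - u) by move=> ? ?; nra.
exists (a + t * (a' - a)), (b + t * (b' - b)), (c + t * (c' - c)).
split; rewrite ?pos//.
  have -> : a' = 1 - b' - c' by rewrite -abc'; ring.
  have -> : a = 1 - b - c by rewrite -abc; ring.
  by ring.
by apply: vec2P; rewrite !mxE; ring.
Qed.

Lemma open_triangle_barycentre p q r :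
  open_triangle p q r (3^-1 *: (p + q + r)).
Proof.
by exists 3^-1, 3^-1, 3^-1; split=> //; [field|rewrite !scalerDr].
Qed.

Lemma open_triangle_closed p q r : open_triangle p q r `<=` closed_triangle p q r.
Proof.
by move=> x [a [b [c [a0 b0 c0 ? ?]]]]; exists a, b, c; split=> //; exact: ltW.
Qed.

Lemma closed_triangle_vertex1 p q r : closed_triangle p q r p.
Proof.
exists 1, 0, 0; split=> //; first by rewrite !addr0.
by rewrite scale1r !scale0r !addr0.
Qed.

Lemma closed_triangle_vertex2 p q r : closed_triangle p q r q.
Proof.
exists 0, 1, 0; split=> //; first by rewrite add0r addr0.
by rewrite scale1r !scale0r add0r addr0.
Qed.

Lemma closed_triangle_vertex3 p q r : closed_triangle p q r r.
Proof.
exists 0, 0, 1; split=> //; first by rewrite !add0r.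
by rewrite scale1r !scale0r !add0r.
Qed.

(** Constant gradient gives an affine map on the open triangle, and continuity
    carries it to the vertices, where the constant term is read off. *)
Lemma affine_on_triangle f M p q r :
  continuous f -> gradient_on (open_triangle p q r) f M ->
  forall x, closed_triangle p q r x -> f x = M *m x + (f p - M *m p).
Proof.
move=> cf gf; set c := 3^-1 *: (p + q + r).
have Tc := open_triangle_barycentre p q r.
have H : forall x, closed_triangle p q r x -> f x = M *m x + (f c - M *m c).
  move=> x /closed_triangle_closure; apply: affine_closure => // y Ty.
  have := affine_of_gradient (@open_triangle_convex p q r) gf Tc Ty.
  rewrite mulmxBr => /eqP; rewrite subr_eq => /eqP ->.
  by rewrite addrAC addrA.
have Hp := closed_triangle_vertex1 p q r.
move=> x /H ->; rewrite (H _ Hp); congr (_ + _).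
by rewrite addrAC subrr add0r.
Qed.

(** The barycentric coordinates [k] are continuous because the edge matrix is
    invertible. *)
Lemma open_open_triangle p q r :
  frame (q - p) (r - p) \in unitmx -> open (open_triangle p q r).
Proof.
move=> uB; pose k x := invmx (frame (q - p) (r - p)) *m (x - p).
have ck i : continuous (fun x => k x i 0).
  move=> x.
  have cxp : {for x, continuous (fun y => y - p)}.
    by apply: continuousB; [exact: cvg_id|exact: cst_continuous].
  have ckx : {for x, continuous k}.
    exact: (continuous_comp cxp (@mulmx_continuous _ _ (x - p))).
  exact: (continuous_comp ckx (@coord_continuous _ _ _ i 0 (k x))).
have -> : open_triangle p q r =
    [set x | 0 < k x 0 0] `&` [set x | 0 < k x 1 0] `&`
    [set x | k x 0 0 + k x 1 0 < 1].
  apply/seteqP; split => x.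
    move=> [a [b [c [a0 b0 c0 abc xE]]]].
    have kE : k x = \col_i (if i == 0 then b else c).
      rewrite /k (_ : x - p = frame (q - p) (r - p) *m \col_i (if i == 0 then b else c)).
        by rewrite mulKmx.
      rewrite frame_mul !mxE /= xE (_ : a = 1 - b - c); last by rewrite -abc; ring.
      by apply: vec2P; rewrite !mxE; ring.
    by rewrite /= kE !mxE /=; split; [split|rewrite -abc -addrA ltrDr].
  move=> [[/= k0 k1] k2].
  exists (1 - (k x 0 0 + k x 1 0)), (k x 0 0), (k x 1 0); split=> //.
- by rewrite subr_gt0.
- by ring.
- have : frame (q - p) (r - p) *m k x = x - p by rewrite /k mulKVmx.
  rewrite frame_mul => /eqP; rewrite eq_sym subr_eq => /eqP xE.
  rewrite [LHS]xE; apply: vec2P; rewrite !mxE; ring.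
apply: openI; first apply: openI.
- apply: (@open_comp _ _ (fun x => k x 0 0) [set z | 0 < z]).
    by move=> x _; exact: ck.
  exact: open_gt.
- apply: (@open_comp _ _ (fun x => k x 1 0) [set z | 0 < z]).
    by move=> x _; exact: ck.
  exact: open_gt.
- have cs : continuous (fun x => k x 0 0 + k x 1 0).
    by move=> x; apply: continuousD; exact: ck.
  apply: (@open_comp _ _ (fun x => k x 0 0 + k x 1 0) [set z | z < 1]).
    by move=> x _; exact: cs.
  exact: open_lt.
Qed.

End Triangles.

(** * Rotations and convex hulls *)

Section Rotations.
Context {R : realType}.
Implicit Types (p q r x y v w : 'cV[R]_2) (s t : R).

Lemma rotationD s t : rotation s *m rotation t = rotation (s + t).
Proof.
by apply/matrixP; apply: forall_ord2; apply: forall_ord2;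
  rewrite mulmx2E !mxE /= ?cosD ?sinD; ring.
Qed.

Lemma rotation0 : rotation 0 = 1%:M :> 'M[R]_2.
Proof.
by apply/matrixP; apply: forall_ord2; apply: forall_ord2;
  rewrite !mxE /= ?cos0 ?sin0 ?oppr0.
Qed.

Lemma trmx_rotation t : (rotation t)^T = rotation (- t).
Proof.
by apply/matrixP; apply: forall_ord2; apply: forall_ord2;
  rewrite !mxE /= ?cosN ?sinN ?opprK.
Qed.

Lemma rotation_basis1 t : rotation t *m basis1 = \col_i (if i == 0 then cos t else sin t).
Proof. by apply: vec2P; rewrite mulmx2E !mxE /= mulr1 mulr0 addr0. Qed.

Lemma rotationVK t (v : 'cV[R]_2) : rotation t *m (rotation (- t) *m v) = v.
Proof. by rewrite mulmxA rotationD subrr rotation0 mul1mx. Qed.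

Lemma det_rotation_frame t v w :
  \det (frame (rotation t *m v) (rotation t *m w)) = \det (frame v w).
Proof.
rewrite !det_frame !mulmx2E !mxE /=.
transitivity ((cos t ^+ 2 + sin t ^+ 2) * (v 0 0 * w 1 0 - v 1 0 * w 0 0)).
  by ring.
by rewrite cos2Dsin2 mul1r.
Qed.

Definition dot v w : R := v 0 0 * w 0 0 + v 1 0 * w 1 0.

Lemma dot_rotation t v w : dot (rotation t *m v) (rotation t *m w) = dot v w.
Proof.
rewrite /dot !mulmx2E !mxE /=.
transitivity ((cos t ^+ 2 + sin t ^+ 2) * (v 0 0 * w 0 0 + v 1 0 * w 1 0)).
  by ring.
by rewrite cos2Dsin2 mul1r.
Qed.

Lemma dot_continuous w : continuous (dot ^~ w).
Proof.
have c i : continuous (fun v : 'cV[R]_2 => v i 0 * w i 0).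
  move=> x; apply: continuousM; last exact: cst_continuous.
  exact: coord_continuous.
move=> x; apply: (@continuousD _ _ _ (fun v => v 0 0 * w 0 0)
  (fun v => v 1 0 * w 1 0)); exact: c.
Qed.

Lemma dotDl u v w : dot (u + v) w = dot u w + dot v w.
Proof. by rewrite /dot !mxE; ring. Qed.

Lemma dotZl (a : R) v w : dot (a *: v) w = a * dot v w.
Proof. by rewrite /dot !mxE; ring. Qed.

End Rotations.

Section ConvexHulls.
Context {R : realType}.
Implicit Types (p q r x y v w : 'cV[R]_2) (s t : R).

Lemma convex_hull_vertex m (f : 'I_m -> 'cV[R]_2) i : convex_hull f (f i).
Proof.
exists (fun k => (k == i)%:R); split=> //.
- by rewrite (bigD1 i)//= eqxx big1 ?addr0// => k /negbTE ->.
- by rewrite (bigD1 i)//= eqxx scale1r big1 ?addr0// => k /negbTE ->; rewrite scale0r.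
Qed.

Lemma convex_hull_triangle m (f : 'I_m -> 'cV[R]_2) p q r :
  convex_hull f p -> convex_hull f q -> convex_hull f r ->
  closed_triangle p q r `<=` convex_hull f.
Proof.
move=> [lp [lp0 lp1 ->]] [lq [lq0 lq1 ->]] [lr [lr0 lr1 ->]] x.
move=> [a [b [c [a0 b0 c0 abc ->]]]].
exists (fun i => a * lp i + b * lq i + c * lr i); split.
- by move=> i; rewrite !addr_ge0 ?mulr_ge0.
- by rewrite !big_split /= -!mulr_sumr lp1 lq1 lr1 !mulr1.
- rewrite !scaler_sumr -!big_split /=; apply: eq_bigr => i _.
  by rewrite !scalerA !scalerDl.
Qed.

(** The triangle with vertices [0], [E], [E'] contains the inner vertex [I1] in
    its interior, so it is the union of the three triangles over its sides with
    apex [I1]; which of them contains [x] is decided by the weight of [x] that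
    is exhausted first when [I1] is subtracted.  The two that contain [0] are
    cut once more by the edges of the inner polygon, which meet the sides
    in [c *: E] and [c *: E']. *)
Lemma sector_cover (E E' I0 I1 I2 x : 'cV[R]_2) (A B c mu l l' : R) :
  0 < A -> 0 < B -> A + B < 1 -> 0 < c < 1 -> 0 <= mu <= 1 ->
  I1 = A *: E + B *: E' ->
  c *: E = (1 - mu) *: I0 + mu *: I1 ->
  c *: E' = (1 - mu) *: I1 + mu *: I2 ->
  0 <= l -> 0 <= l' -> l + l' <= 1 -> x = l *: E + l' *: E' ->
  [\/ closed_triangle 0 I0 I1 x, closed_triangle 0 I1 I2 x |
   [\/ closed_triangle E I0 I1 x, closed_triangle E I1 E' x |
       closed_triangle E' I1 I2 x]].
Proof.
move=> A0 B0 AB /andP[c0 c1] /andP[mu0 mu1] I1E cE cE' l0 l'0 ll' xE.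
(* The triangle [0, e, J1] is cut by the segment from [c *: e] to [J1], which
   lies on the line through [J0] and [J1]. *)
have split_side (e J0 J1 y : 'cV[R]_2) (nu s t : R) : 0 <= nu <= 1 ->
    c *: e = (1 - nu) *: J0 + nu *: J1 ->
    0 <= s -> 0 <= t -> s + t <= 1 -> y = s *: e + t *: J1 ->
    closed_triangle 0 J0 J1 y \/ closed_triangle e J0 J1 y.
  move=> /andP[nu0 nu1] ceE s0 t0 st yE.
  have eE : e = c^-1 *: ((1 - nu) *: J0 + nu *: J1).
    by rewrite -ceE scalerA mulVf ?scale1r// gt_eqF.
  have [le|gt] := leP s (c * (1 - t)); [left|right].
    exists (1 - s / c - t), (s / c * (1 - nu)), (s / c * nu + t).
    have sc0 : 0 <= s / c by rewrite divr_ge0// ltW.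
    split=> //.
    - by rewrite addrAC subr_ge0 ler_pdivrMr// mulrC.
    - by rewrite mulr_ge0// subr_ge0.
    - by rewrite addr_ge0// mulr_ge0.
    - by ring.
    - by rewrite yE eE; apply: vec2P; rewrite !mxE; field; rewrite gt_eqF.
  pose rho := (1 - s - t) / (1 - c).
  have rho0 : 0 <= rho by rewrite divr_ge0//; lra.
  have r1 : rho * (1 - c) = 1 - s - t by rewrite /rho divfK// subr_eq0 gt_eqF.
  exists (1 - t - rho), (rho * (1 - nu)), (rho * nu + t); split=> //.
  - by rewrite subr_ge0 /rho ler_pdivrMr ?subr_gt0//; lra.
  - by rewrite mulr_ge0// subr_ge0.
  - by rewrite addr_ge0// mulr_ge0.
  - by ring.
  - rewrite yE -[RHS]addrA.
    have -> : (rho * (1 - nu)) *: J0 + (rho * nu + t) *: J1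
       = (rho * c) *: e + t *: J1.
      by rewrite -[(rho * c) *: e]scalerA ceE; apply: vec2P; rewrite !mxE; ring.
    rewrite addrA -scalerDl; congr (_ *: _ + _).
    by symmetry; transitivity (1 - t - rho * (1 - c)); [ring|rewrite r1; ring].
have swap (p q r y : 'cV[R]_2) :
    closed_triangle p q r y -> closed_triangle p r q y.
  move=> [a [b [d [? ? ? e ->]]]]; exists a, d, b; split=> //.
    by rewrite addrAC.
  by rewrite addrAC.
(* [C], [A], [B] are the weights of [I1], and [l0'], [l], [l'] those of [x], with
   respect to [0], [E], [E']. *)
pose C := 1 - A - B.
have C0 : 0 < C by rewrite /C; lra.
pose l0' := 1 - l - l'.
have l00 : 0 <= l0' by rewrite /l0'; lra.
have middle : l0' / C <= l / A -> l0' / C <= l' / B ->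
    closed_triangle E I1 E' x.
  rewrite ler_pdivlMr// (mulrC _ A) => hA; rewrite ler_pdivlMr// (mulrC _ B) => hB.
  exists (l - A * (l0' / C)), (l0' / C), (l' - B * (l0' / C)).
  split; rewrite ?subr_ge0 ?divr_ge0 ?(ltW C0)//.
    rewrite (_ : _ + _ = l + l' + l0' / C * C); last by rewrite /C; ring.
    by rewrite divfK ?gt_eqF// /l0'; ring.
  by rewrite xE I1E; apply: vec2P; rewrite !mxE; ring.
have [h1|/ltW h1] := leP (l' / B) (l / A).
  have [h2|/ltW h2] := leP (l' / B) (l0' / C); last first.
    by apply/Or33/Or32/middle => //; exact: le_trans h1.
  have hA : A * (l' / B) <= l by rewrite mulrC -ler_pdivlMr.
  have hC : C * (l' / B) <= l0' by rewrite mulrC -ler_pdivlMr.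
  have eB : B * (l' / B) = l' by rewrite mulrC divfK// gt_eqF.
  have [||||||H|H] := @split_side E I0 I1 x mu (l - A * (l' / B)) (l' / B).
  - by rewrite mu0 mu1.
  - by [].
  - by rewrite subr_ge0.
  - by rewrite divr_ge0// ltW.
  - by move: hC; rewrite /C /l0'; lra.
  - by rewrite xE I1E -{1}eB; apply: vec2P; rewrite !mxE; ring.
  - exact: Or31.
  - exact/Or33/Or31.
have [h2|/ltW h2] := leP (l / A) (l0' / C); last first.
  by apply/Or33/Or32/middle => //; exact: le_trans h1.
have hB : B * (l / A) <= l' by rewrite mulrC -ler_pdivlMr.
have hC : C * (l / A) <= l0' by rewrite mulrC -ler_pdivlMr.
have eA : A * (l / A) = l by rewrite mulrC divfK// gt_eqF.
have [||||||H|H] := @split_side E' I2 I1 x (1 - mu) (l' - B * (l / A)) (l / A).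
- by rewrite subr_ge0 mu1 gerBl mu0.
- by rewrite cE' addrC; congr (_ *: _ + _); ring.
- by rewrite subr_ge0.
- by rewrite divr_ge0// ltW.
- by move: hC; rewrite /C /l0'; lra.
- by rewrite xE I1E -{1}eA; apply: vec2P; rewrite !mxE; ring.
- exact/Or32/swap.
- exact/Or33/Or33/swap.
Qed.

End ConvexHulls.

(** * Sectors of the outer polygon *)

Section Polygons.
Context {R : realType} (n : nat) (hn : (3 <= n)%N).
Implicit Types (p q r x y v w : 'cV[R]_2) (s t alpha : R).

Let n_gt0 : 0 < n%:R :> R.
Proof. by rewrite ltr0n (leq_trans _ hn). Qed.

Let n_ge3 : 3 <= n%:R :> R.
Proof. by rewrite (ler_nat R 3). Qed.

Lemma rotQD s t : rotQ n s *m rotQ n t = rotQ n (s + t).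
Proof. by rewrite /rotQ rotationD -mulrDr. Qed.

Lemma rotQ0 : rotQ n 0 = 1%:M :> 'M[R]_2.
Proof. by rewrite /rotQ mulr0 rotation0. Qed.

Lemma rotQ_period s : rotQ n (s + n%:R) = rotQ n s.
Proof.
have -> : rotQ n (s + n%:R) = rotation (2 * pi / n%:R * s + pi *+ 2).
  rewrite /rotQ mulrDr divfK ?gt_eqF// mulr_natl. reflexivity.
by apply/matrixP => i j; rewrite !mxE sinD2pi cosD2pi.
Qed.

Lemma outer_vertexD k i :
  outer_vertex n (k + i) = rotQ n k%:R *m outer_vertex n i :> 'cV[R]_2.
Proof. by rewrite /outer_vertex mulmxA rotQD natrD addrA. Qed.

Lemma inner_vertexD alpha k i :
  inner_vertex n alpha (k + i) = rotQ n k%:R *m inner_vertex n alpha i.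
Proof. by rewrite /inner_vertex -scalemxAr mulmxA rotQD natrD !addrA. Qed.

Lemma outer_vertex_period i : outer_vertex n (i + n) = outer_vertex n i :> 'cV[R]_2.
Proof. by rewrite /outer_vertex natrD addrAC rotQ_period. Qed.

Lemma inner_vertex_period alpha i :
  inner_vertex n alpha (i + n) = inner_vertex n alpha i.
Proof. by rewrite /inner_vertex natrD -!addrA (addrC n%:R) !addrA rotQ_period. Qed.

Lemma half_angle_bounds : 0 < (pi : R) / n%:R <= pi / 3.
Proof.
by rewrite divr_gt0 ?pi_gt0//= ler_pM2l ?pi_gt0// lef_pV2// posrE.
Qed.

Lemma sin_half_gt0 : 0 < sin ((pi : R) / n%:R).
Proof.
have /andP[? ?] := half_angle_bounds; have := @pi_gt0 R => ?.
by apply: sin_gt0_pi; lra.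
Qed.

Lemma cos_half_gt0 : 0 < cos ((pi : R) / n%:R).
Proof.
have /andP[? ?] := half_angle_bounds; have := @pi_gt0 R => ?.
by apply: cos_gt0_pihalf; lra.
Qed.

Lemma angleE s : 2 * pi / n%:R * s = pi / n%:R * (2 * s).
Proof. by ring. Qed.

Lemma sin_angle_gt0 s : 0 < s <= 1 -> 0 < sin (2 * pi / n%:R * s).
Proof.
move=> /andP[s0 s1]; have /andP[w0 w1] := half_angle_bounds.
have := @pi_gt0 R => p0.
rewrite angleE; apply: sin_gt0_pi; apply/andP; split.
  by apply: mulr_gt0 => //; exact: mulr_gt0.
have : pi / n%:R * (2 * s) <= pi / n%:R * 2 by rewrite ler_wpM2l ?(ltW w0)//; lra.
lra.
Qed.

(** The direction of the midpoint of the outer edge from [outer_vertex n i.+1]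
    to [outer_vertex n i.+2]. *)
Definition edge_normal i : 'cV[R]_2 := rotQ n (i%:R + 2^-1) *m basis1.

Lemma edge_normal_mod k : edge_normal (k %% n) = edge_normal k.
Proof.
rewrite [in RHS](divn_eq k n) /edge_normal.
elim: (k %/ n)%N => [|m IH]; first by rewrite mul0n.
by rewrite IH mulSn -addnA (addnC n) [in RHS]natrD addrAC rotQ_period.
Qed.

Lemma dot_rotQ s t :
  dot (rotQ n s *m basis1) (rotQ n t *m basis1) = cos (2 * pi / n%:R * (s - t)).
Proof.
by rewrite /rotQ !rotation_basis1 /dot !mxE /= mulrBr cosB.
Qed.

(** The sector is selected by the normal on which [x] has the largest component:
    comparing with the two neighbouring normals puts [x] on the right side of
    both rays, and two rays at an angle less than [pi] span their sector. *)
Lemma sector_exists x : exists i l l', [/\ (i < n)%N, 0 <= l, 0 <= l' &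
  x = l *: outer_vertex n i.+1 + l' *: outer_vertex n i.+2].
Proof.
have n0 : (0 < n)%N by rewrite (leq_trans _ hn).
have [i _ imax] := @Order.TotalTheory.arg_maxP _ _ _ (Ordinal n0) xpredT
  (fun k : 'I_n => dot x (edge_normal k)) isT.
have {}imax k : dot x (edge_normal k) <= dot x (edge_normal i).
  by rewrite -edge_normal_mod; exact: (imax (Ordinal (ltn_pmod k n0))).
pose y := rotation (- (2 * pi / n%:R * i%:R)) *m x.
have xE : x = rotQ n i%:R *m y by rewrite /rotQ rotationVK.
have normalE t k : edge_normal k = rotQ n i%:R *m (rotQ n t *m basis1) ->
    dot x (edge_normal k) =
    y 0 0 * cos (2 * pi / n%:R * t) + y 1 0 * sin (2 * pi / n%:R * t).
  by move=> ->; rewrite xE dot_rotation /rotQ rotation_basis1 /dot !mxE.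
set w : R := pi / n%:R.
have E0 : dot x (edge_normal i) = y 0 0 * cos w + y 1 0 * sin w.
  rewrite (normalE 2^-1) ?mulmxA ?rotQD// (_ : _ * 2^-1 = w)// /w.
  by field; rewrite gt_eqF.
have E1 : dot x (edge_normal i.+1) =
    y 0 0 * cos (w + w + w) + y 1 0 * sin (w + w + w).
  rewrite (normalE (1 + 2^-1)) ?mulmxA ?rotQD; last first.
    by rewrite /edge_normal -natr1 addrA.
  rewrite (_ : _ * (1 + _) = w + w + w)// /w; field; rewrite gt_eqF//.
(* [i + n.-1] is the index before [i], modulo [n]. *)
have E2 : dot x (edge_normal (i + n.-1)) = y 0 0 * cos w - y 1 0 * sin w.
  rewrite (normalE (- 2^-1)) ?mulmxA ?rotQD; last first.
    rewrite /edge_normal -[in RHS]rotQ_period natrD -subn1 natrB//.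
    by congr (rotQ n _ *m _); field.
  rewrite (_ : _ * (- _) = - w) ?cosN ?sinN ?mulrN// /w; field; rewrite gt_eqF//.
have s0 := sin_half_gt0; have c0 := cos_half_gt0; rewrite -/w in s0 c0.
have H1 := imax i.+1; have H2 := imax (i + n.-1)%N.
rewrite E0 E1 !(cosD, sinD) in H1; rewrite E0 E2 in H2.
have cs := cos2Dsin2 w.
set c := cos w in s0 c0 H1 H2 cs; set s := sin w in s0 c0 H1 H2 cs.
have y1 : 0 <= y 1 0 by rewrite -(pmulr_lge0 _ s0); lra.
have e2 : outer_vertex n 2 =
    \col_k (if k == 0 then c ^+ 2 - s ^+ 2 else 2 * s * c) :> 'cV[R]_2.
  rewrite /outer_vertex /rotQ rotation_basis1 (_ : _ * _ = w + w).
    by apply: vec2P; rewrite !mxE /= ?cosD ?sinD -/c -/s; ring.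
  by rewrite /w; field; rewrite gt_eqF.
have key : 0 <= 2 * s * c * y 0 0 - (c ^+ 2 - s ^+ 2) * y 1 0.
  have -> : 2 * s * c * y 0 0 - (c ^+ 2 - s ^+ 2) * y 1 0 =
    (2 * s)^-1 * (y 0 0 * c + y 1 0 * s -
     (y 0 0 * ((c * c - s * s) * c - (s * c + c * s) * s) +
      y 1 0 * ((s * c + c * s) * c + (c * c - s * s) * s)) +
     (c ^+ 2 + s ^+ 2 - 1) * (y 0 0 * c + y 1 0 * s)).
    by field; rewrite gt_eqF.
  by rewrite cs subrr mul0r addr0 mulr_ge0 ?invr_ge0 ?mulr_ge0 ?(ltW s0)// subr_ge0.
have S0 : 0 < 2 * s * c by rewrite !mulr_gt0.
exists i, (y 0 0 - (c ^+ 2 - s ^+ 2) * (y 1 0 / (2 * s * c))), (y 1 0 / (2 * s * c)).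
split=> //.
- have -> : y 0 0 - (c ^+ 2 - s ^+ 2) * (y 1 0 / (2 * s * c)) =
    (2 * s * c * y 0 0 - (c ^+ 2 - s ^+ 2) * y 1 0) / (2 * s * c).
    by field; rewrite !gt_eqF.
  by rewrite divr_ge0// ltW.
- by rewrite divr_ge0// ltW.
rewrite -(addn2 i) -(addn1 i) (outer_vertexD i 1) (outer_vertexD i 2) [LHS]xE.
rewrite [X in X + _]scalemxAr [X in _ + X]scalemxAr -mulmxDr; congr (_ *m _).
rewrite e2 /outer_vertex subrr rotQ0 mul1mx.
by apply: vec2P; rewrite !mxE /=; field; rewrite !gt_eqF.
Qed.

End Polygons.

(** * Membership in the two polygons *)

Section PolygonMembership.
Context {R : realType} (n : nat) (hn : (3 <= n)%N).
Implicit Types (p q r x y v w : 'cV[R]_2) (s t alpha : R).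

Let n_pos : (0 < n)%N. Proof. exact: leq_trans hn. Qed.

Let n_gt0 : 0 < n%:R :> R.
Proof. by rewrite ltr0n. Qed.

Lemma outer_vertex_modn i :
  outer_vertex n (i %% n).+1 = outer_vertex n i.+1 :> 'cV[R]_2.
Proof.
rewrite [in RHS](divn_eq i n).
elim: (i %/ n)%N => [|m IH]; first by rewrite mul0n.
by rewrite IH mulSn -addnA (addnC n) -[in RHS]addSn outer_vertex_period.
Qed.

Lemma inner_vertex_modn alpha i :
  inner_vertex n alpha (i %% n).+1 = inner_vertex n alpha i.+1.
Proof.
rewrite [in RHS](divn_eq i n).
elim: (i %/ n)%N => [|m IH]; first by rewrite mul0n.
by rewrite IH mulSn -addnA (addnC n) -[in RHS]addSn inner_vertex_period.
Qed.

Lemma outer_vertex_in i : outer_polygon n (outer_vertex n i.+1 : 'cV[R]_2).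
Proof.
rewrite -outer_vertex_modn.
exact: (convex_hull_vertex (fun k : 'I_n => outer_vertex n k.+1)
  (Ordinal (ltn_pmod i n_pos))).
Qed.

Lemma inner_vertex_in alpha i : inner_polygon n alpha (inner_vertex n alpha i).
Proof.
rewrite -inner_vertex_period//.
have -> : (i + n = (i + n.-1).+1)%N by rewrite -addnS prednK.
rewrite -inner_vertex_modn.
exact: (convex_hull_vertex (fun k : 'I_n => inner_vertex n alpha k.+1)
  (Ordinal (ltn_pmod _ n_pos))).
Qed.

(** Multiplication by [rotQ n 1] permutes the summands cyclically, and
    [rotQ n 1 - 1] is invertible. *)
Lemma sum_rotQ : \sum_(i < n) rotQ n i%:R = 0 :> 'M[R]_2.
Proof.
set S := \sum_(i < n) _.
have SE : (rotQ n 1 - 1%:M) *m S = 0.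
  rewrite mulmxBl mul1mx {1}/S mulmx_sumr.
  rewrite -(big_mkord xpredT (fun i => rotQ n 1 *m rotQ n i%:R)).
  rewrite /S -(big_mkord xpredT (fun i => rotQ n i%:R)) -sumrB.
  under eq_bigr do rewrite rotQD nat1r.
  by rewrite telescope_sumr// -[n%:R]add0r rotQ_period// subrr.
have u : rotQ n 1 - 1%:M \in @unitmx R 2.
  rewrite unitmxE unitfE.
  have -> : rotQ n 1 - 1%:M = frame
      (\col_k (if k == 0 then cos (2 * pi / n%:R * 1) - 1
                        else sin (2 * pi / n%:R * 1)))
      (\col_k (if k == 0 then - sin (2 * pi / n%:R * 1)
                        else cos (2 * pi / n%:R * 1) - 1)) :> 'M[R]_2.
    by apply/matrixP; apply: forall_ord2; apply: forall_ord2; rewrite !mxE /= ?subr0.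
  rewrite det_frame !mxE /= gt_eqF//.
  have := @sin_angle_gt0 R n hn 1; rewrite ltr01 lexx => /(_ isT) s0.
  by rewrite mulrN opprK ltr_wpDl ?mulr_gt0// -expr2 sqr_ge0.
by rewrite -(mulKmx u S) SE mulmx0.
Qed.

Lemma convex_hull_rotQ0 v : convex_hull (fun i : 'I_n => rotQ n i%:R *m v) 0.
Proof.
exists (fun=> n%:R^-1); split=> //.
- by rewrite sumr_const card_ord -[_ *+ _]mulr_natr mulVf// gt_eqF.
- by rewrite -scaler_sumr -mulmx_suml sum_rotQ mul0mx scaler0.
Qed.

Lemma outer_polygon0 : outer_polygon n (0 : 'cV[R]_2).
Proof.
have := convex_hull_rotQ0 (outer_vertex n 1).
by congr (convex_hull _ _); apply/funext => i; rewrite -outer_vertexD addn1.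
Qed.

Lemma inner_polygon0 alpha : inner_polygon n alpha 0.
Proof.
have := convex_hull_rotQ0 (inner_vertex n alpha 1).
by congr (convex_hull _ _); apply/funext => i; rewrite -inner_vertexD addn1.
Qed.

Lemma dot_outer_vertex k i :
  dot (outer_vertex n k.+1) (edge_normal n i) =
  cos (pi / n%:R * (2 * (k%:R - i%:R) - 1)) :> R.
Proof.
rewrite /outer_vertex /edge_normal dot_rotQ; congr cos.
by rewrite -natr1; field; rewrite gt_eqF.
Qed.

(** Every vertex of a regular polygon lies below the line of each edge. *)
Lemma cos_chord_le t : pi / n%:R <= t <= 2 * pi - pi / n%:R ->
  cos t <= cos (pi / n%:R).
Proof.
have /andP[w0 w1] := @half_angle_bounds R n hn.
have p0 := @pi_gt0 R => /andP[t1 t2].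
have H s : pi / n%:R <= s <= pi -> cos s <= cos (pi / n%:R).
  move=> /andP[s1 s2]; move: s1; rewrite le_eqVlt => /predU1P[->//|s1].
  by rewrite ltW// ltr_cos// in_itv /=; lra.
have [tp|tp] := leP t pi; first by apply: H; rewrite t1.
have -> : cos t = cos (2 * pi - t).
  by rewrite -[RHS]cosN opprB -[RHS]cosD2pi mulr_natl subrK.
by apply: H; lra.
Qed.

Lemma outer_polygon_halfplane x i :
  outer_polygon n x -> dot x (edge_normal n i) <= cos (pi / n%:R).
Proof.
move=> [l [l0 l1 ->]]; rewrite -edge_normal_mod//.
have : (i %% n < n)%N by rewrite ltn_mod.
move: (i %% n)%N => {}i ltin.
have -> : dot (\sum_k l k *: outer_vertex n k.+1) (edge_normal n i) =
    \sum_(k < n) l k * dot (outer_vertex n k.+1) (edge_normal n i).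
  elim/big_rec2: _ => [|k a b _ IH]; first by rewrite /dot !mxE !mul0r addr0.
  by rewrite dotDl IH dotZl.
have -> : cos (pi / n%:R) = \sum_k l k * cos (pi / n%:R).
  by rewrite -mulr_suml l1 mul1r.
apply: ler_sum => k _.
rewrite ler_wpM2l// dot_outer_vertex.
have /andP[w0 w1] := @half_angle_bounds R n hn.
have wn : pi / n%:R * n%:R = pi :> R by rewrite divfK// gt_eqF.
have [ki|ik] := leqP k i.
  rewrite -[leLHS]cosN; apply: cos_chord_le.
  have -> : - (pi / n%:R * (2 * (k%:R - i%:R) - 1)) =
            pi / n%:R * (2 * (i - k)%:R + 1) :> R by rewrite natrB//; ring.
  have h0 : 0 <= (i - k)%:R :> R by [].
  have h1 : (i - k)%:R + 1 <= n%:R :> R.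
    by rewrite natr1 ler_nat (leq_ltn_trans (leq_subr _ _)).
  move: ((i - k)%:R) h0 h1 => d d0 d1.
  set w := pi / n%:R in w0 w1 wn *; rewrite -wn; apply/andP; split; nra.
apply: cos_chord_le; rewrite -natrB ?(ltnW ik)//.
have h0 : 1 <= (k - i)%:R :> R by rewrite ler1n subn_gt0.
have h1 : (k - i)%:R <= n%:R :> R.
  by rewrite ler_nat (leq_trans (leq_subr _ _))// ltnW.
move: ((k - i)%:R) h0 h1 => d d0 d1.
set w := pi / n%:R in w0 w1 wn *; rewrite -wn; apply/andP; split; nra.
Qed.

Lemma dot_sector i (l l' : R) :
  dot (l *: outer_vertex n i.+1 + l' *: outer_vertex n i.+2) (edge_normal n i) =
  (l + l') * cos (pi / n%:R).
Proof.
rewrite dotDl !dotZl !dot_outer_vertex -[i.+1%:R]natr1 subrr mulr0 sub0r mulrN1 cosN.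
by rewrite (_ : _ * (_ - 1) = pi / n%:R) ?mulrDl//; ring.
Qed.

Lemma outer_sector_triangle i (l l' : R) : 0 <= l -> 0 <= l' -> l + l' <= 1 ->
  outer_polygon n (l *: outer_vertex n i.+1 + l' *: outer_vertex n i.+2).
Proof.
move=> l0 l'0 ll'.
apply: (convex_hull_triangle outer_polygon0 (outer_vertex_in i) (outer_vertex_in i.+1)).
exists (1 - (l + l')), l, l'; split=> //; first by rewrite subr_ge0.
  by ring.
by rewrite scaler0 add0r.
Qed.

(** The outer polygon is the intersection of the half-planes of its edges: within
    a sector the component on the edge normal measures the sum of the two
    weights. *)
Lemma outer_polygonPn x :
  ~ outer_polygon n x <-> exists i, cos (pi / n%:R) < dot x (edge_normal n i).
Proof.
split=> [nx|[i lti] /outer_polygon_halfplane - /(_ i)]; last by rewrite leNgt lti.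
have [i [l [l' [_ l0 l'0 xE]]]] := sector_exists hn x.
exists i; rewrite xE dot_sector ltr_pMl ?cos_half_gt0// ltNge.
by apply: contra_notN nx => ll'; rewrite xE; exact: outer_sector_triangle.
Qed.

Lemma open_outside : open (~` (outer_polygon n : set 'cV[R]_2)).
Proof.
have -> : ~` (outer_polygon n : set 'cV[R]_2) =
    \bigcup_i [set x | cos (pi / n%:R) < dot x (edge_normal n i)].
  apply/seteqP; split => x; first by move=> /outer_polygonPn[i ?]; exists i.
  by move=> [i _ ?]; apply/outer_polygonPn; exists i.
apply: bigcup_open => i _.
apply: (@open_comp _ _ (dot ^~ (edge_normal n i)) [set z | cos (pi / n%:R) < z]).
  by move=> x _; exact: dot_continuous.
exact: open_gt.
Qed.

(** Pushing a vertex outwards along its own ray leaves the polygon. *)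
Lemma outer_vertex_closure i :
  closure (~` outer_polygon n) (outer_vertex n i.+1 : 'cV[R]_2).
Proof.
set x := outer_vertex n i.+1 => B nB.
pose y (t : R) := (1 + t) *: x.
have cy : {for 0, continuous y}.
  have c : {for 0, continuous (fun t : R => 1 + t)}.
    by apply: continuousD; [exact: cst_continuous|exact: cvg_id].
  exact: (continuous_comp c (@scalel_continuous _ _ x (1 + 0))).
have nyB : \forall t \near (0 : R), B (y t).
  by apply: cy; rewrite /y addr0 scale1r.
have [/= d d0 dB] := (nbhs_ballP _ _).1 nyB.
exists (y (d / 2)); split; last first.
  by apply: dB; rewrite /ball /= sub0r normrN gtr0_norm; lra.
apply/outer_polygonPn; exists i.
rewrite /y dotZl -[x]scale1r -[1 *: x]addr0 -(scale0r (outer_vertex n i.+2)).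
rewrite dot_sector addr0 mul1r ltr_pMl ?cos_half_gt0//; lra.
Qed.

End PolygonMembership.

(** * The triangulation of the annulus *)

Section ContiTriangulation.
Context {R : realType} (n : nat) (hn : (3 <= n)%N).
Implicit Types (p q r x y v w : 'cV[R]_2) (s t alpha : R).

Let n_gt0 : 0 < n%:R :> R.
Proof. by rewrite ltr0n (leq_trans _ hn). Qed.

(** The [j]-th triangle has the vertices [outer_vertex n j.+1./2] and
    [inner_vertex n alpha j./2] for both parities of [j]; only the remaining one
    depends on the parity. *)
Definition third_vertex alpha (j : nat) : 'cV[R]_2 :=
  if odd j then inner_vertex n alpha j.+1./2 else outer_vertex n (j./2).+1.

Lemma conti_triangleE alpha j : (0 < j)%N ->
  conti_triangle n alpha j =
  open_triangle (outer_vertex n j.+1./2) (inner_vertex n alpha j./2)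
    (third_vertex alpha j).
Proof.
case: j => // k _; rewrite /conti_triangle /third_vertex /=.
by rewrite uphalf_half; case: (odd k).
Qed.

Definition closed_conti_triangle alpha j : set 'cV[R]_2 :=
  closed_triangle (outer_vertex n j.+1./2) (inner_vertex n alpha j./2)
    (third_vertex alpha j).

(** The last two inequalities say that the first inner vertex lies on the inner
    side of the first outer edge, and that the edges of the inner polygon meet
    the rays through the outer vertices inside the unit disc. *)
Definition admissible alpha : Prop :=
  [/\ 0 < alpha < 1, 0 < inner_radius n alpha,
      inner_radius n alpha * (sin (2 * pi / n%:R * alpha) +
        sin (2 * pi / n%:R * (1 - alpha))) < sin (2 * pi / n%:R) &
      inner_radius n alpha * sin (2 * pi / n%:R) <
      sin (2 * pi / n%:R * alpha) + sin (2 * pi / n%:R * (1 - alpha))].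

(** A point in the sector of two consecutive outer vertices is either beyond the
    outer edge or handled by [sector_cover]. *)
Lemma conti_cover alpha : admissible alpha -> forall x : 'cV[R]_2,
  [\/ ~ outer_polygon n x, inner_polygon n alpha x |
      exists2 j, (1 <= j <= 2 * n)%N & closed_conti_triangle alpha j x].
Proof.
move=> [/andP[a0 a1] r0 AB c1] x.
have [i [l [l' [ltin l0 l'0 xE]]]] := sector_exists hn x.
have [ll'|ll'] := leP (l + l') 1; last first.
  apply: Or31; apply/(outer_polygonPn hn); exists i.
  by rewrite xE dot_sector// ltr_pMl// cos_half_gt0.
set W : R := 2 * pi / n%:R in AB c1.
set r := inner_radius n alpha in r0 AB c1.
set sA := sin (W * (1 - alpha)) in AB c1; set sB := sin (W * alpha) in AB c1.
have sA0 : 0 < sA by apply: sin_angle_gt0 => //; lra.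
have sB0 : 0 < sB by apply: sin_angle_gt0 => //; lra.
have S0 : 0 < sin W.
  by rewrite -[W]mulr1; apply: sin_angle_gt0 => //; lra.
have AB0 : 0 < sB + sA by rewrite addr_gt0.
(* [A] and [B] are the coordinates of the first inner vertex in the basis of the
   first two outer vertices; [c] is the distance at which the edge between
   inner vertices [0] and [1] meets the ray of the first outer vertex, and [mu]
   the position of this point on the edge. *)
pose A := r * sA / sin W; pose B := r * sB / sin W.
pose c := r * sin W / (sB + sA); pose mu := sA / (sB + sA).
have sAE : sA = sin W * cos (W * alpha) - cos W * sB.
  by rewrite /sA mulrBr mulr1 sinB.
have E1E : outer_vertex n 1 = \col_k (if k == 0 then 1 else 0) :> 'cV[R]_2.
  rewrite /outer_vertex subrr rotQ0 mul1mx; apply: vec2P; rewrite !mxE //=.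
have E2E : outer_vertex n 2 = \col_k (if k == 0 then cos W else sin W) :> 'cV[R]_2.
  by rewrite /outer_vertex /rotQ rotation_basis1 (_ : 2 - 1 = 1) ?mulr1//; ring.
have I0E : inner_vertex n alpha 0 =
    \col_k (if k == 0 then r * cos (W * (1 - alpha)) else - (r * sA)) :> 'cV[R]_2.
  rewrite /inner_vertex /rotQ rotation_basis1 (_ : 0 - 1 + alpha = - (1 - alpha)); last by ring.
  by apply: vec2P; rewrite !mxE /= mulrN ?cosN// sinN mulrN.
have I1E : inner_vertex n alpha 1 =
    \col_k (if k == 0 then r * cos (W * alpha) else r * sB) :> 'cV[R]_2.
  rewrite /inner_vertex /rotQ rotation_basis1 subrr add0r.
  by apply: vec2P; rewrite !mxE.
have cE1 : c *: outer_vertex n 1 = (1 - mu) *: inner_vertex n alpha 0 +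
    mu *: inner_vertex n alpha 1 :> 'cV[R]_2.
  have cA : cos (W * (1 - alpha)) = cos W * cos (W * alpha) + sin W * sB.
    by rewrite mulrBr mulr1 cosB.
  have num : sB * (cos W * cos (W * alpha) + sin W * sB) + sA * cos (W * alpha) = sin W.
    rewrite sAE; transitivity (sin W * (cos (W * alpha) ^+ 2 + sB ^+ 2)); first by ring.
    by rewrite cos2Dsin2 mulr1.
  rewrite E1E I0E I1E /c /mu; apply: vec2P; rewrite !mxE /=.
    by rewrite cA mulr1 -{1}num; field; rewrite gt_eqF.
  by rewrite mulr0; field; rewrite gt_eqF.
have I1A : inner_vertex n alpha 1 =
    A *: outer_vertex n 1 + B *: outer_vertex n 2 :> 'cV[R]_2.
  rewrite E1E E2E I1E /A /B; apply: vec2P; rewrite !mxE /=.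
    by rewrite {1}sAE; field; rewrite gt_eqF.
  by field; rewrite gt_eqF.
have tr (k i0 i1 i2 : nat) (a b d : R) :
    a *: outer_vertex n i0 =
      b *: inner_vertex n alpha i1 + d *: inner_vertex n alpha i2 :> 'cV[R]_2 ->
    a *: outer_vertex n (k + i0) = b *: inner_vertex n alpha (k + i1) +
      d *: inner_vertex n alpha (k + i2) :> 'cV[R]_2.
  by move=> e; rewrite outer_vertexD !inner_vertexD !scalemxAr -mulmxDr -scalemxAr e.
have I1A' : inner_vertex n alpha i.+1 =
    A *: outer_vertex n i.+1 + B *: outer_vertex n i.+2 :> 'cV[R]_2.
  rewrite -(addn2 i) -(addn1 i) inner_vertexD !outer_vertexD I1A mulmxDr.
  by rewrite -!scalemxAr.
have mu01 : 0 <= mu <= 1.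
  by rewrite /mu divr_ge0 ?(ltW sA0) ?(ltW AB0)//= ler_pdivrMr// mul1r lerDr ltW.
have c01 : 0 < c < 1.
  apply/andP; split; first by apply: divr_gt0 => //; exact: mulr_gt0.
  by rewrite /c ltr_pdivrMr// mul1r.
have H1 := tr i 1%N 0%N 1%N _ _ _ cE1; rewrite addn1 addn0 in H1.
have H2 := tr i.+1 1%N 0%N 1%N _ _ _ cE1; rewrite addn1 addn0 in H2.
have [|||H|H|[H|H|H]] := sector_cover _ _ _ c01 mu01 I1A' H1 H2 l0 l'0 ll' xE.
- by apply: divr_gt0 => //; exact: mulr_gt0.
- by apply: divr_gt0 => //; exact: mulr_gt0.
- by rewrite /A /B -mulrDl -mulrDr ltr_pdivrMr// mul1r addrC.
- apply: Or32; move: x H {xE}.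
  by apply: convex_hull_triangle;
    [exact: inner_polygon0|exact: inner_vertex_in|exact: inner_vertex_in].
- apply: Or32; move: x H {xE}.
  by apply: convex_hull_triangle;
    [exact: inner_polygon0|exact: inner_vertex_in|exact: inner_vertex_in].
- apply: Or33; exists i.*2.+1; first by rewrite /= mul2n ltn_double.
  by rewrite /closed_conti_triangle /third_vertex /= odd_double /= uphalf_double doubleK.
- apply: Or33; exists i.*2.+2; first by rewrite /= mul2n -doubleS leq_double.
  by rewrite /closed_conti_triangle /third_vertex /= odd_double /= uphalf_double doubleK.
(* The last sector borders on the first triangle again. *)
- apply: Or33; have [iE|ine] := eqVneq i.+1 n.
    exists 1%N; first by rewrite /= mul2n -iE.
    rewrite /closed_conti_triangle /third_vertex /=.
    move: H; rewrite iE -[n.+1]/(1 + n)%N outer_vertex_period// inner_vertex_period//.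
    by rewrite -[n in inner_vertex n alpha n]add0n inner_vertex_period.
  exists i.+1.*2.+1; first by apply/andP; split=> //; rewrite mul2n ltn_double ltn_neqAle ine.
  rewrite /closed_conti_triangle /third_vertex /= odd_double /= uphalf_double doubleK.
  exact: H.
Qed.

End ContiTriangulation.

(** * Vertices and triangles near alpha = 1/2 *)

Section ContiSmoothness.
Context {R : realType} (n : nat) (hn : (3 <= n)%N).
Implicit Types (p q r x y v w : 'cV[R]_2) (s t alpha : R).

Let n_gt0 : 0 < n%:R :> R.
Proof. by rewrite ltr0n (leq_trans _ hn). Qed.

Local Notation hf := (2^-1 : R).

Lemma angle_half : 2 * pi / n%:R * hf = pi / n%:R.
Proof. by field; rewrite gt_eqF. Qed.

Lemma onem_half : 1 - hf = hf.
Proof. by field. Qed.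

Lemma sin_half_lt1 : sin (pi / n%:R) < 1 :> R.
Proof.
rewrite lt_neqAle sin_le1 andbT; apply/eqP => s1.
have := cos2Dsin2 (pi / n%:R : R); rewrite s1.
have := @cos_half_gt0 R n hn; nra.
Qed.

Lemma inner_radius_half :
  inner_radius n hf = (1 - sin (pi / n%:R)) / cos (pi / n%:R).
Proof.
rewrite /inner_radius onem_half angle_half divff// subrr mulr0 cos0.
by rewrite -expr2 sqrtr_sqr gtr0_norm ?sin_half_gt0// mulrC.
Qed.

Lemma derivable_sin_left : derivable (fun s => sin (2 * pi / n%:R * s)) hf 1.
Proof.
rewrite (_ : (fun s => _) = (fun s => sin (0 + 2 * pi / n%:R * s))).
  exact: derivable_sin_affine.
by apply/funext => s; rewrite add0r.
Qed.

Lemma derivable_sin_right :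
  derivable (fun s => sin (2 * pi / n%:R * (1 - s))) hf 1.
Proof.
rewrite (_ : (fun s => _) =
  (fun s => sin (2 * pi / n%:R + (- (2 * pi / n%:R)) * s))).
  exact: derivable_sin_affine.
by apply/funext => s; congr sin; ring.
Qed.

Lemma derivable_inner_radius : derivable (inner_radius n) hf 1.
Proof.
apply: derivableM; first exact: derivable_cst.
apply: derivableB.
  rewrite (_ : (fun s => _) =
    (fun s => cos (pi / n%:R + (- (2 * pi / n%:R)) * s))).
    exact: derivable_cos_affine.
  by apply/funext => s; congr cos; ring.
apply: derivable_sqrt_comp.
  by rewrite onem_half angle_half mulr_gt0// sin_half_gt0.
by apply: derivableM; [exact: derivable_sin_left|exact: derivable_sin_right].
Qed.

(** With [w = pi / n] the radius at [1/2] is [(1 - sin w) / cos w], for which the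
    inequalities reduce to [0 < sin w < 1]; they persist by continuity. *)
Lemma admissible_near : \forall s \near hf, admissible n s.
Proof.
have cr := derivable_continuous1 derivable_inner_radius.
have csl := derivable_continuous1 derivable_sin_left.
have csr := derivable_continuous1 derivable_sin_right.
set w : R := pi / n%:R.
have s0 : 0 < sin w by exact: sin_half_gt0.
have c0 : 0 < cos w by exact: cos_half_gt0.
have s1 : sin w < 1 by exact: sin_half_lt1.
have WE : 2 * pi / n%:R = w + w by rewrite /w; ring.
have cs := cos2Dsin2 w.
have r0 : 0 < inner_radius n hf.
  by rewrite inner_radius_half// divr_gt0// subr_gt0.
have rc : inner_radius n hf * cos w = 1 - sin w.
  by rewrite inner_radius_half// divfK// gt_eqF.
have c1 : {for hf, continuous (fun s => inner_radius n s * (sin (2 * pi / n%:R * s) +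
        sin (2 * pi / n%:R * (1 - s))))}.
  by apply: continuousM => //; apply: continuousD.
have c2 : {for hf, continuous (fun s => sin (2 * pi / n%:R * s) +
        sin (2 * pi / n%:R * (1 - s)) - inner_radius n s * sin (2 * pi / n%:R))}.
  apply: continuousB; first by apply: continuousD.
  by apply: continuousM => //; exact: cst_continuous.
have h1 : \forall s \near hf, inner_radius n s * (sin (2 * pi / n%:R * s) +
        sin (2 * pi / n%:R * (1 - s))) < sin (2 * pi / n%:R).
  apply: (cvgr_lt _ c1); rewrite onem_half angle_half WE sinD -/w.
  have -> : inner_radius n hf * (sin w + sin w) = 2 * sin w * inner_radius n hf by ring.
  have -> : sin w * cos w + cos w * sin w = 2 * sin w * cos w by ring.
  rewrite ltr_pM2l ?mulr_gt0// -(ltr_pM2r c0) rc.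
  rewrite (_ : cos w * cos w = 1 - sin w ^+ 2); last by rewrite -cs; ring.
  nra.
have h2 : \forall s \near hf, 0 < sin (2 * pi / n%:R * s) +
        sin (2 * pi / n%:R * (1 - s)) - inner_radius n s * sin (2 * pi / n%:R).
  apply: (cvgr_gt _ c2); rewrite onem_half angle_half WE sinD -/w.
  have -> : sin w + sin w - inner_radius n hf * (sin w * cos w + cos w * sin w) =
     2 * sin w * (1 - inner_radius n hf * cos w) by ring.
  by rewrite rc !mulr_gt0// subKr.
have h3 : \forall s \near hf, 0 < inner_radius n s by exact: (cvgr_gt _ cr).
have h4 : \forall s \near hf, 0 < s :> R by apply: lt_nbhsr; lra.
have h5 : \forall s \near hf, s < 1 :> R by apply: lt_nbhsl; lra.
near=> s; split.
- by apply/andP; split; near: s.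
- by near: s.
- by near: s.
- by rewrite -subr_gt0; near: s.
Unshelve. all: by end_near. Qed.

Lemma derivable_inner_vertex i : derivable (inner_vertex n ^~ i) hf 1.
Proof.
apply: derivable_scalemx; first exact: derivable_inner_radius.
apply: derivable_mulmx; last exact: derivable_cst.
rewrite (_ : (fun s => _) =
  (fun s => rotation (2 * pi / n%:R * (i%:R - 1) + 2 * pi / n%:R * s))).
  exact: derivable_rotation_affine.
by apply/funext => s; rewrite -mulrDr.
Qed.

Lemma derivable_third_vertex j : derivable (third_vertex n ^~ j) hf 1.
Proof.
rewrite /third_vertex; case: (odd j); first exact: derivable_inner_vertex.
exact: derivable_cst.
Qed.

(** Up to a rotation there are only the two triangles at the first outer
    vertex. *)
Lemma conti_triangle_nondegenerate j : (0 < j)%N ->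
  frame (inner_vertex n hf j./2 - outer_vertex n j.+1./2)
        (third_vertex n hf j - outer_vertex n j.+1./2) \in unitmx.
Proof.
move=> j0; rewrite unitmxE unitfE.
set w : R := pi / n%:R.
have s0 : 0 < sin w by exact: sin_half_gt0.
have c0 : 0 < cos w by exact: cos_half_gt0.
have s1 : sin w < 1 by exact: sin_half_lt1.
have cs := cos2Dsin2 w.
have rE := inner_radius_half.
have r0 : 0 < inner_radius n hf.
  by rewrite inner_radius_half// divr_gt0// subr_gt0.
have rc : inner_radius n hf * cos w = 1 - sin w.
  by rewrite inner_radius_half// divfK// gt_eqF.
set r := inner_radius n hf in r0 rc.
have E1E : outer_vertex n 1 = \col_k (if k == 0 then 1 else 0) :> 'cV[R]_2.
  by rewrite /outer_vertex subrr rotQ0 mul1mx; apply: vec2P; rewrite !mxE.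
have E2E : outer_vertex n 2 = \col_k (if k == 0 then cos w * cos w - sin w * sin w
   else sin w * cos w + cos w * sin w) :> 'cV[R]_2.
  rewrite /outer_vertex /rotQ rotation_basis1 (_ : _ * _ = w + w); last first.
    by rewrite /w; field; rewrite gt_eqF.
  by rewrite cosD sinD.
have I0E : inner_vertex n hf 0 =
    \col_k (if k == 0 then r * cos w else - (r * sin w)) :> 'cV[R]_2.
  rewrite /inner_vertex /rotQ rotation_basis1 (_ : 0 - 1 + hf = - hf); last by field.
  by apply: vec2P; rewrite !mxE /= mulrN angle_half ?cosN// sinN mulrN.
have I1E : inner_vertex n hf 1 =
    \col_k (if k == 0 then r * cos w else r * sin w) :> 'cV[R]_2.
  rewrite /inner_vertex /rotQ rotation_basis1 subrr add0r angle_half.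
  by apply: vec2P; rewrite !mxE.
have jE : j = ((j.-1)./2.*2 + (odd j.-1).+1)%N.
  by rewrite addnS addnC odd_double_half prednK.
move: (j.-1)./2 jE => i jE; rewrite jE.
case: (odd j.-1) => /=.
  rewrite addn2 /third_vertex /= odd_double /= uphalf_double doubleK.
  rewrite -(addn2 i) -(addn1 i) inner_vertexD !outer_vertexD -!mulmxBr.
  rewrite det_rotation_frame det_frame I1E E1E E2E !mxE /= rc.
  rewrite lt_eqF// -(ltr_pM2r c0) mul0r.
  have -> : ((1 - sin w - 1) * (sin w * cos w + cos w * sin w - 0) -
     (r * sin w - 0) * (cos w * cos w - sin w * sin w - 1)) * cos w =
     sin w * ((r * cos w) * (1 - cos w ^+ 2 + sin w ^+ 2) - 2 * sin w * cos w ^+ 2).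
    by ring.
  have -> : cos w ^+ 2 = 1 - sin w ^+ 2 by rewrite -cs; ring.
  rewrite rc pmulr_rlt0// opprB addrA addrAC subrr add0r.
  have -> : (1 - sin w) * (sin w ^+ 2 + sin w ^+ 2) - 2 * sin w * (1 - sin w ^+ 2) =
     - (2 * sin w * (1 - sin w)) by ring.
  by rewrite oppr_lt0 !mulr_gt0// subr_gt0.
rewrite addn1 /third_vertex /= odd_double /= uphalf_double doubleK.
rewrite -[X in inner_vertex n hf X](addn0 i) -(addn1 i).
rewrite !inner_vertexD !outer_vertexD -!mulmxBr.
rewrite det_rotation_frame det_frame I1E I0E E1E !mxE /= rc.
have -> : (1 - sin w - 1) * (r * sin w - 0) - (- (r * sin w) - 0) * (1 - sin w - 1) =
  - (2 * r * sin w ^+ 2) by ring.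
rewrite oppr_eq0 gt_eqF//; apply: mulr_gt0; last exact: exprn_gt0.
exact: mulr_gt0.
Qed.

End ContiSmoothness.

(** * The stretches near alpha = 1/2 *)

Section StretchTensors.
Context {R : realType} (n : nat) (hn : (3 <= n)%N).
Implicit Types (p q r x y v w : 'cV[R]_2) (s t alpha : R).

Local Notation hf := (2^-1 : R).

Let d alpha : 'cV[R]_2 := inner_vertex n alpha 1 - outer_vertex n 1.

Let d_gt0 : 0 < \sum_i d hf i 0 ^+ 2.
Proof.
have s0 := @sin_half_gt0 R n hn; have c0 := @cos_half_gt0 R n hn.
have s1 := @sin_half_lt1 R n hn.
rewrite (_ : \sum_i _ = d hf 0 0 ^+ 2 + d hf 1 0 ^+ 2); last first.
  by rewrite !big_ord_recl big_ord0 addr0; congr (_ + d hf _ _ ^+ 2); exact: val_inj.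
rewrite ltr_wpDl ?sqr_ge0// exprn_even_gt0//= /d /inner_vertex /outer_vertex.
rewrite subrr add0r /rotQ !rotation_basis1 !mxE /= mulr0 sin0 subr0.
rewrite angle_half// inner_radius_half// gt_eqF// mulr_gt0// divr_gt0//.
by rewrite subr_gt0.
Qed.

Let derivable_d : derivable d hf 1.
Proof.
by apply: derivableB; [exact: derivable_inner_vertex|exact: derivable_cst].
Qed.

Lemma derivable_conti_e11 : derivable (conti_e11 n) hf 1.
Proof.
apply: derivable_scalemx; last exact: derivable_d.
apply: derivableV; first by rewrite gt_eqF// sqrtr_gt0.
apply: derivable_sqrt_comp => //.
have -> : (fun s => \sum_i d s i 0 ^+ 2) = \sum_i (fun s => d s i 0 ^+ 2).
  by apply/funext => s; rewrite fct_sumE.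
apply: derivable_sum => i.
have /derivable_mxP/(_ i 0) di := derivable_d.
exact: (@derivableX _ _ (fun s => d s i 0) 2).
Qed.

Let e11_unit : conti_e11 n hf 0 0 ^+ 2 + conti_e11 n hf 1 0 ^+ 2 = 1.
Proof.
have E : \sum_i d hf i 0 ^+ 2 = d hf 0 0 ^+ 2 + d hf 1 0 ^+ 2.
  by rewrite !big_ord_recl big_ord0 addr0; congr (_ + d hf _ _ ^+ 2); exact: val_inj.
have e0 := d_gt0.
rewrite /conti_e11 -/(d hf) mxE [X in _ + X ^+ 2]mxE !exprMn -mulrDr -E.
rewrite exprVn sqr_sqrtr ?(ltW e0)// mulVf// gt_eqF//.
Qed.

Lemma perpE x : perp x = \col_i (if i == 0 then - x 1 0 else x 0 0).
Proof.
by apply: vec2P; rewrite mulmx2E !mxE /= cos_pihalf sin_pihalf; ring.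
Qed.

Lemma derivable_tensor (f g : R -> 'cV[R]_2) (t : R) :
  derivable f t 1 -> derivable g t 1 -> derivable (fun s => tensor (f s) (g s)) t 1.
Proof. by move=> df dg; apply: derivable_mulmx => //; exact: derivable_trmx. Qed.

Lemma derivable_perp_e11 : derivable (fun s => perp (conti_e11 n s)) hf 1.
Proof.
by apply: derivable_mulmx; [exact: derivable_cst|exact: derivable_conti_e11].
Qed.

Lemma derivable_conti_P0 : derivable (conti_P0 n) hf 1.
Proof.
have de := derivable_conti_e11; have dp := derivable_perp_e11.
exact: (derivableB (derivable_tensor de de) (derivable_tensor dp dp)).
Qed.

Lemma conti_a_half : conti_a n hf = 1.
Proof.
rewrite /conti_a onem_half angle_half// divff ?sqrtr1// gt_eqF//.
exact: sin_half_gt0.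
Qed.

Lemma derivable_conti_a : derivable (conti_a n) hf 1.
Proof.
have s0 := @sin_half_gt0 R n hn.
apply: derivable_sqrt_comp.
  by rewrite onem_half angle_half// divr_gt0.
apply: derivableM; first exact: derivable_sin_right.
apply: derivableV; last exact: derivable_sin_left.
by rewrite angle_half// gt_eqF.
Qed.

Lemma derivable_conti_U : derivable (conti_U n) hf 1.
Proof.
have da := derivable_conti_a.
have dV : derivable (fun s => (conti_a n s)^-1) hf 1.
  by apply: derivableV => //; rewrite conti_a_half oner_neq0.
have de := derivable_conti_e11; have dp := derivable_perp_e11.
apply: derivableD; first apply: derivableD.
- exact: (derivable_scalemx da (derivable_tensor de de)).
- exact: (derivable_scalemx dV (derivable_tensor dp dp)).
apply: derivable_scalemx; last exact: (derivable_tensor de dp).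
by apply: derivableM; [exact: (derivableB dV da)|exact: derivable_cst].
Qed.

Lemma conti_U_half : conti_U n hf = 1%:M.
Proof.
rewrite /conti_U conti_a_half invr1 subrr mul0r scale0r addr0 !scale1r.
rewrite /tensor perpE; have := e11_unit; move: (conti_e11 n hf) => e e1.
apply/matrixP; apply: forall_ord2; apply: forall_ord2;
  rewrite !mxE !big_ord_recl !big_ord0 !mxE /= ?addr0.
- by rewrite -e1; ring.
- by ring.
- by ring.
- by rewrite -e1; ring.
Qed.

(** [conti_P0] is the reflection in the line of [conti_e11]. *)
Lemma conti_P0_half : conti_P0 n hf *m conti_P0 n hf = 1%:M.
Proof.
rewrite /conti_P0 /tensor perpE; have := e11_unit; move: (conti_e11 n hf) => e e1.
have e1' : (e 0 0 ^+ 2 + e 1 0 ^+ 2) ^+ 2 = 1 by rewrite e1 expr1n.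
apply/matrixP; apply: forall_ord2; apply: forall_ord2; rewrite mulmx2E;
  rewrite !mxE !big_ord_recl !big_ord0 !mxE /= ?addr0.
- by rewrite -e1'; ring.
- by ring.
- by ring.
- by rewrite -e1'; ring.
Qed.

Lemma rotQ_conj1 s : rotQ n s *m (rotQ n s)^T = 1%:M :> 'M[R]_2.
Proof. by rewrite trmx_rotation rotationD subrr rotation0. Qed.

Lemma conti_Uj_half j : conti_Uj n hf j = 1%:M.
Proof.
rewrite /conti_Uj conti_U_half !mulmx1 conti_P0_half mulmx1.
by case: ifP => _; rewrite rotQ_conj1.
Qed.

Lemma derivable_conti_Uj j : derivable (conti_Uj n ^~ j) hf 1.
Proof.
rewrite /conti_Uj; case: (odd j).
  apply: derivable_mulmx; last exact: derivable_cst.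
  by apply: derivable_mulmx; [exact: derivable_cst|exact: derivable_conti_U].
apply: derivable_mulmx; last exact: derivable_cst.
apply: derivable_mulmx; first exact: derivable_cst.
apply: derivable_mulmx; last exact: derivable_conti_P0.
by apply: derivable_mulmx; [exact: derivable_conti_P0|exact: derivable_conti_U].
Qed.

End StretchTensors.

(** * The velocity field *)

Section Linearisation.
Context {R : realType} (n : nat) (hn : (3 <= n)%N)
  (u : R -> 'cV[R]_2 -> 'cV[R]_2)
  (hu : forall alpha : R, 0 < alpha < 1 -> nonlinear_conti n alpha (u alpha)).
Implicit Types (p q r x y v w : 'cV[R]_2) (s t alpha : R).

Local Notation hf := (2^-1 : R).
Local Notation outer j := (outer_vertex n j.+1./2).
Local Notation inner := (fun j alpha => inner_vertex n alpha j./2).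
Local Notation third := (fun j alpha => third_vertex n alpha j).

Lemma near_half01 : \forall s \near hf, 0 < s < 1.
Proof. by apply: filterS (admissible_near hn) => s []. Qed.

Lemma u_continuous alpha : 0 < alpha < 1 -> continuous (u alpha).
Proof. by move=> /hu[+ _ _ _]; exact: locally_lipschitz_continuous. Qed.

Lemma u_outer alpha i : 0 < alpha < 1 ->
  u alpha (outer_vertex n i.+1) = outer_vertex n i.+1.
Proof.
move=> a01; have [_ uid _ _] := hu a01.
rewrite -[RHS]mul1mx -[RHS]addr0.
apply: (affine_closure (u_continuous a01)); last exact: outer_vertex_closure.
by move=> x /uid ->; rewrite mul1mx addr0.
Qed.

Lemma u_inner alpha i : 0 < alpha < 1 ->
  u alpha (inner_vertex n alpha i) = rotQ n (1 - 2 * alpha) *m inner_vertex n alpha i.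
Proof.
by move=> /hu[_ _ ur _]; apply: ur; exact: inner_vertex_in.
Qed.

(** On the [j]-th triangle the gradient is constant, so that its value at the
    barycentre stands for all of them. *)
Definition conti_gradient j alpha : 'M[R]_2 :=
  grad (u alpha) (3^-1 *: (outer j + inner j alpha + third j alpha)).

Lemma u_triangle alpha j : 0 < alpha < 1 -> (1 <= j <= 2 * n)%N ->
  forall x, closed_conti_triangle n alpha j x ->
  u alpha x = conti_gradient j alpha *m x +
    (u alpha (outer j) - conti_gradient j alpha *m outer j).
Proof.
move=> a01 jn; have [_ _ _ [RE _ /(_ j jn)]] := hu a01.
have /andP[j0 _] := jn; rewrite conti_triangleE// => Gj x.
suff -> : conti_gradient j alpha = RE^T *m conti_Uj n alpha j.
  exact: (affine_on_triangle (u_continuous a01) Gj).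
by have [] := Gj _ (open_triangle_barycentre _ _ _).
Qed.

(** The unknown rotation cancels in the Cauchy-Green tensor. *)
Lemma conti_gradient_cauchy_green alpha j : 0 < alpha < 1 ->
  (1 <= j <= 2 * n)%N ->
  (conti_gradient j alpha)^T *m conti_gradient j alpha =
  (conti_Uj n alpha j)^T *m conti_Uj n alpha j.
Proof.
move=> a01 jn; have [_ _ _ [RE [RE1 _] /(_ j jn)]] := hu a01.
have /andP[j0 _] := jn; rewrite conti_triangleE// => Gj.
have -> : conti_gradient j alpha = RE^T *m conti_Uj n alpha j.
  by have [] := Gj _ (open_triangle_barycentre _ _ _).
by rewrite trmx_mul trmxK mulmxA -(mulmxA _ RE) RE1 mulmx1.
Qed.

Definition spin : 'M[R]_2 := derive1 (fun alpha => rotQ n (1 - 2 * alpha)) hf.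

Lemma rotQ_spin_half : rotQ n (1 - 2 * hf) = 1%:M :> 'M[R]_2.
Proof. by rewrite divff// subrr rotQ0. Qed.

Lemma is_derive_spin : is_derive hf 1 (fun alpha => rotQ n (1 - 2 * alpha)) spin.
Proof.
rewrite /spin derive1E; apply/derivableP.
rewrite (_ : (fun s => _) =
  (fun s => rotation (2 * pi / n%:R + (- (2 * pi / n%:R * 2)) * s))).
  exact: derivable_rotation_affine.
by apply/funext => s; congr rotation; ring.
Qed.

(** Along a curve of rotations the Cauchy-Green tensor is constant. *)
Lemma skew_spin : skew_mx spin.
Proof.
have : sym_part spin = sym_part 0.
  have D0 := is_derive_cst (1%:M : 'M[R]_2) hf (1 : R).
  have orth : \forall s \near hf, (rotQ n (1 - 2 * s))^T *m rotQ n (1 - 2 * s)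
      = (cst 1%:M s)^T *m cst 1%:M s :> 'M[R]_2.
    apply: filterS near_half01 => s _; rewrite /cst trmx1 mulmx1 trmx_rotation rotationD addNr.
    exact: rotation0.
  exact: (@sym_part_derive_congr _ (fun s => rotQ n (1 - 2 * s)) (cst 1%:M)
    hf _ _ rotQ_spin_half erefl is_derive_spin D0 orth).
rewrite /sym_part trmx0 addr0 scaler0 => /eqP.
by rewrite scaler_eq0 invr_eq0 (negbTE (_ : 2 != 0))//= addrC addr_eq0 => /eqP.
Qed.

Lemma is_derive_spin1 : is_derive hf 1 (fun alpha => rotQ n (1 - 2 * alpha) - 1%:M) spin.
Proof.
have C := is_derive_cst (1%:M : 'M[R]_2) hf (1 : R).
by apply: is_derive_eq (is_deriveB is_derive_spin C) _; rewrite subr0.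
Qed.

Let rotQ_spin1_half : rotQ n (1 - 2 * hf) - 1%:M = 0.
Proof. by rewrite rotQ_spin_half subrr. Qed.

(** The rate of the displacement at the moving vertex: the displacement factor
    [rotQ n (1 - 2 * alpha) - 1] vanishes at [1/2], so the motion of the vertex
    itself does not contribute. *)
Lemma is_derive_u_inner i :
  is_derive hf 1 (fun s => u s (inner_vertex n s i) - inner_vertex n s i)
    (spin *m inner_vertex n hf i).
Proof.
have dI := @derivable_inner_vertex R n hn i.
have D := is_derive_mulmx_zero rotQ_spin1_half is_derive_spin1 dI.
apply: near_eq_is_derive D.
apply: filterS near_half01 => s s01.
by rewrite u_inner// mulmxBl mul1mx.
Qed.

Lemma is_derive_u_outer i :
  is_derive hf 1 (fun s => u s (outer_vertex n i.+1) - outer_vertex n i.+1) 0.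
Proof.
have D := is_derive_cst (0 : 'cV[R]_2) hf (1 : R).
apply: near_eq_is_derive D.
by apply: filterS near_half01 => s s01; rewrite u_outer// subrr.
Qed.

Definition third_velocity j : 'cV[R]_2 :=
  if odd j then spin *m third j hf else 0.

Lemma is_derive_u_third j :
  is_derive hf 1 (fun s => u s (third j s) - third j s) (third_velocity j).
Proof.
rewrite /third_velocity /third_vertex; case: (odd j).
  exact: is_derive_u_inner.
exact: is_derive_u_outer.
Qed.

(** The matrix that maps the two edges issuing from the outer vertex to the
    differences of the velocities at their ends, the outer vertex being at
    rest. *)
Definition displacement_gradient j : 'M[R]_2 :=
  frame (spin *m inner j hf) (third_velocity j) *m
  invmx (frame (inner j hf - outer j) (third j hf - outer j)).

Lemma outer_succ j : (0 < j)%N -> exists i, j.+1./2 = i.+1.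
Proof. by case: j => // j _; exists j./2. Qed.

Lemma u_half_inner i : u hf (inner_vertex n hf i) = inner_vertex n hf i.
Proof. by rewrite u_inner ?(nbhs_singleton near_half01)// rotQ_spin_half mul1mx. Qed.

Lemma u_half_outer i : u hf (outer_vertex n i.+1) = outer_vertex n i.+1.
Proof. by rewrite u_outer ?(nbhs_singleton near_half01). Qed.

Lemma u_half_third j : u hf (third j hf) = third j hf.
Proof.
rewrite /third_vertex; case: (odd j); [exact: u_half_inner|exact: u_half_outer].
Qed.

Lemma is_derive_conti_gradient j : (1 <= j <= 2 * n)%N ->
  conti_gradient j hf - 1%:M = 0 /\
  is_derive hf 1 (fun s => conti_gradient j s - 1%:M) (displacement_gradient j).
Proof.
move=> jn; have /andP[j0 _] := jn; have [i jE] := outer_succ j0.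
pose w s x := u s x - x.
have dO := is_derive_u_outer i; rewrite -jE in dO.
have E : is_derive hf 1 (fun s => frame (w s (inner j s) - w s (outer j))
      (w s (third j s) - w s (outer j)))
    (frame (spin *m inner j hf) (third_velocity j)).
  have F := is_derive_frame (is_deriveB (is_derive_u_inner j./2) dO)
    (is_deriveB (is_derive_u_third j) dO).
  by rewrite !subr0 in F.
apply: (is_derive_mulmx_cancel (B := fun s =>
  frame (inner j s - outer j) (third j s - outer j)) _ E).
- apply: filterS near_half01 => s s01.
  have A x : closed_conti_triangle n s j x ->
      (conti_gradient j s - 1%:M) *m (x - outer j) = w s x - w s (outer j).
    move=> /(u_triangle s01 jn); rewrite /w => ->.
    by rewrite mulmxBr !mulmxBl !mul1mx; apply: vec2P; rewrite !mxE; ring.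
  by rewrite mul_frame !A//; [exact: closed_triangle_vertex3|exact: closed_triangle_vertex2].
- have uo : u hf (outer j) = outer j by rewrite jE u_half_outer.
  rewrite /w u_half_third u_half_inner uo !subrr.
  exact: frame0.
- have D : derivable (fun s => frame (inner j s - outer j) (third j s - outer j)) hf 1.
    have dc := is_derive_cst (outer j : 'cV[R]_2) hf (1 : R).
    have dI := derivableP (@derivable_inner_vertex R n hn j./2).
    have dT := derivableP (@derivable_third_vertex R n hn j).
    by have [] := is_derive_frame (is_deriveB dI dc) (is_deriveB dT dc).
  exact: derivable_continuous1.
- exact: conti_triangle_nondegenerate.
Qed.

(** The finitely many affine pieces of [u s - id] have gradients that vanish at
    [s = 1/2] and are differentiable there, hence of order [s - 1/2]. *)
Lemma displacement_lipschitz : exists L : R, \forall s \near hf, forall p q,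
  `|(u s p - p) - (u s q - q)| <= L * `|s - hf| * `|p - q|.
Proof.
pose I := option (option 'I_(2 * n)).
pose M (i : I) s : 'M[R]_2 := match i with
  | None => 0
  | Some None => rotQ n (1 - 2 * s) - 1%:M
  | Some (Some j) => conti_gradient j.+1 s - 1%:M end.
pose b (i : I) s : 'cV[R]_2 := match i with
  | None | Some None => 0
  | Some (Some j) => u s (outer j.+1) - conti_gradient j.+1 s *m outer j.+1 end.
have MK i : exists K : R, 0 <= K /\ \forall s \near hf, `|M i s| <= K * `|s - hf|.
  case: i => [[j|]|].
  - have [A0 dA] :=
      is_derive_conti_gradient (ltn_ord j : (1 <= j.+1 <= 2 * n)%N).
    exact: (is_derive_zero_near_le A0 dA).
  - exact: (is_derive_zero_near_le rotQ_spin1_half is_derive_spin1).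
  - exists 0; split=> //; apply: filterS near_half01 => s _.
    by rewrite normr0 mul0r.
have [K K0 KM] : exists2 K : I -> R, forall i, 0 <= K i &
    forall i, \forall s \near hf, `|M i s| <= K i * `|s - hf|.
  by have [K HK] := choice MK; exists K => i; have [] := HK i.
exists (2%:R * \sum_i K i).
have KMall : \forall s \near hf, forall i, `|M i s| <= K i * `|s - hf|.
  have FF : Filter (nbhs hf) := nbhs_filter hf.
  exact: (@filter_forall _ _ (fun i s => `|M i s| <= K i * `|s - hf|) (nbhs hf) FF KM).
near=> s; move=> p q.
have s01 : 0 < s < 1 by near: s; exact: near_half01.
have adm : admissible n s by near: s; exact: admissible_near.
have Ms : forall i, `|M i s| <= K i * `|s - hf| by near: s.
apply: (@lipschitz_selection _ _ _ I (fun x => u s x - x)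
  (fun i x => M i s *m x + b i s)).
- move=> x; apply: (@continuousB _ _ _ (u s) id x); last exact: cvg_id.
  exact: u_continuous.
- move=> i x y; rewrite opprD addrACA subrr addr0 -mulmxBr.
  rewrite (le_trans (normr_mulmx_le _ _))// ler_wpM2r// -!mulrA ler_wpM2l//.
  rewrite (le_trans (Ms i))// ler_wpM2r// (bigD1 i)//= lerDl.
  by rewrite sumr_ge0.
- move=> x; have [_ uid ur _] := hu s01.
  have [xo|xi|[j jn xj]] := conti_cover hn adm x.
  + by exists None; rewrite uid//= mul0mx subrr addr0.
  + by exists (Some None); rewrite ur//= mulmxBl mul1mx addr0.
  + case: j jn xj => // j jn xj; have jlt : (j < 2 * n)%N by [].
    exists (Some (Some (Ordinal jlt))).
    rewrite (u_triangle s01 jn xj) mulmxBl mul1mx.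
    exact: addrAC.
Unshelve. all: by end_near. Qed.

Lemma is_derive_u_outside x : ~ outer_polygon n x -> is_derive hf 1 (u ^~ x) 0.
Proof.
move=> xo; have D := is_derive_cst x hf (1 : R).
apply: near_eq_is_derive D.
by apply: filterS near_half01 => s /hu[_ uid _ _]; rewrite uid.
Qed.

(** The curve through [x] is the combination of the moving inner vertices with
    the weights of [x] at [1/2]; it stays in the moving inner polygon. *)
Lemma is_derive_u_inside x : inner_polygon n hf x ->
  is_derive hf 1 (u ^~ x) (spin *m x).
Proof.
move=> [l [l0 l1 xE]]; have [L HL] := displacement_lipschitz.
pose y s := \sum_i l i *: inner_vertex n s (nat_of_ord i).+1.
have dy : derivable y hf 1.
  rewrite (_ : y = \sum_i (fun s => l i *: inner_vertex n s (nat_of_ord i).+1)); last first.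
    by apply/funext => s; rewrite fct_sumE.
  apply: derivable_sum => i.
  by apply: derivable_scalemx; [exact: derivable_cst|exact: derivable_inner_vertex].
rewrite xE -/(y hf).
apply: (is_derive_moving_point HL (derivable_continuous1 dy)).
have D := is_derive_mulmx_zero rotQ_spin1_half is_derive_spin1 dy.
apply: near_eq_is_derive D.
apply: filterS near_half01 => s /hu[_ _ ur _].
by rewrite ur ?mulmxBl ?mul1mx//; exists l.
Qed.

(** As for the inner polygon, with the moving vertices of the triangle. *)
Lemma is_derive_u_triangle j x : (1 <= j <= 2 * n)%N ->
  closed_conti_triangle n hf j x ->
  is_derive hf 1 (u ^~ x)
    (displacement_gradient j *m x - displacement_gradient j *m outer j).
Proof.
move=> jn [a [b [c [a0 b0 c0 abc xE]]]]; have [L HL] := displacement_lipschitz.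
have /andP[j0 _] := jn; have [i jE] := outer_succ j0.
pose y s := a *: outer j + b *: inner j s + c *: third j s.
have dy : derivable y hf 1.
  apply: derivableD; first apply: derivableD; first exact: derivable_cst.
    by apply: derivable_scalemx; [exact: derivable_cst|exact: derivable_inner_vertex].
  by apply: derivable_scalemx; [exact: derivable_cst|exact: derivable_third_vertex].
rewrite xE -/(y hf).
apply: (is_derive_moving_point HL (derivable_continuous1 dy)).
have [A0 dA] := is_derive_conti_gradient jn.
have dz := derivableB dy (derivable_cst (outer j) hf (1 : R)).
have D := is_derive_mulmx_zero A0 dA dz.
rewrite mulmxBr in D.
apply: near_eq_is_derive D.
apply: filterS near_half01 => s s01.
have uo : u s (outer j) = outer j by rewrite jE u_outer.
rewrite (u_triangle s01 jn (x := y s)); last by exists a, b, c.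
rewrite uo mulmxBl mul1mx mulmxBr; apply: vec2P; rewrite !mxE; ring.
Qed.

Lemma u_derivable x : derivable (u ^~ x) hf 1.
Proof.
have adm : admissible n hf := nbhs_singleton (admissible_near hn).
have [/is_derive_u_outside|/is_derive_u_inside|[j jn /(is_derive_u_triangle jn)]] :=
  conti_cover hn adm x; by case.
Qed.

Lemma u_half x : u hf x = x.
Proof.
have h01 := nbhs_singleton near_half01.
have [_ uid ur _] := hu h01.
have [xo|xi|[j jn xj]] := conti_cover hn (nbhs_singleton (admissible_near hn)) x.
- exact: uid.
- by rewrite ur// rotQ_spin_half mul1mx.
- rewrite (u_triangle h01 jn xj).
  have [/eqP + _] := is_derive_conti_gradient jn; rewrite subr_eq0 => /eqP ->.
  have /andP[j0 _] := jn; have [i ->] := outer_succ j0.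
  by rewrite u_half_outer !mul1mx subrr addr0.
Qed.

Let v0 x : 'cV[R]_2 := derive1 (fun alpha => u alpha x) hf.

Lemma v0E x D : is_derive hf 1 (u ^~ x) D -> v0 x = D.
Proof. by rewrite /v0 derive1E => -[_ <-]. Qed.

(** The bound of [displacement_lipschitz] divided by [s - 1/2] passes to the
    limit. *)
Lemma v0_continuous : continuous v0.
Proof.
have [L HL] := displacement_lipschitz.
have vL x y : `|v0 x - v0 y| <= L * `|x - y|.
  have D z : is_derive hf 1 (u ^~ z) (v0 z).
    by rewrite /v0 derive1E; apply: derivableP; exact: u_derivable.
  apply: is_derive_norm_le (is_deriveB (D x) (D y)).
  apply: filterS HL => s /(_ x y); rewrite mulrAC => H.
  apply: le_trans H; rewrite !fctE /= !u_half.
  rewrite le_eqVlt; apply/orP; left; apply/eqP; congr (`|_|).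
  by apply: vec2P; rewrite !mxE; ring.
move=> x; have FF : Filter (nbhs x) := nbhs_filter x.
apply/(@cvgrPdist_le _ _ _ (nbhs x)) => e e0.
have L1 : 0 < `|L| + 1 by rewrite ltr_wpDl.
have /cvgrPdist_le := @cvg_id _ (nbhs x).
move=> /(_ (e / (`|L| + 1))) /(_ (divr_gt0 e0 L1)); apply: filterS => y Hy.
rewrite (le_trans (vL _ _))//.
apply: (@le_trans _ _ ((`|L| + 1) * `|x - y|)).
  by rewrite ler_wpM2r// (le_trans (ler_norm _))// lerDl.
by rewrite mulrC -ler_pdivlMr.
Qed.

Lemma v0_outside x : ~ outer_polygon n x -> v0 x = 0.
Proof. move=> xo; exact: (v0E (is_derive_u_outside xo)). Qed.

Lemma v0_inside x : inner_polygon n hf x -> v0 x = spin *m x.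
Proof. move=> xi; exact: (v0E (is_derive_u_inside xi)). Qed.

Lemma v0_triangle j x : (1 <= j <= 2 * n)%N -> closed_conti_triangle n hf j x ->
  v0 x = displacement_gradient j *m x +
         (- (displacement_gradient j *m outer_vertex n j.+1./2)).
Proof. move=> jn xj; exact: (v0E (is_derive_u_triangle jn xj)). Qed.

Lemma v0_gradient_triangle j : (1 <= j <= 2 * n)%N ->
  gradient_on (conti_triangle n hf j) v0 (displacement_gradient j).
Proof.
move=> jn; have /andP[j0 _] := jn; rewrite conti_triangleE//.
apply: (gradient_on_affine (b := - (displacement_gradient j *m outer_vertex n j.+1./2))).
  exact: open_open_triangle (conti_triangle_nondegenerate hn j0).
move=> x /open_triangle_closed; exact: v0_triangle.
Qed.

Lemma displacement_strain j : (1 <= j <= 2 * n)%N ->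
  sym_part (displacement_gradient j) = linearized_strain n j :> 'M[R]_2.
Proof.
move=> jn; have [A0 dA] := is_derive_conti_gradient jn.
have dU := derivableP (@derivable_conti_Uj R n hn j).
rewrite /linearized_strain (derive1_sym_part dU).
have dG : is_derive hf 1 (conti_gradient j) (displacement_gradient j).
  have H := is_deriveD dA (is_derive_cst (1%:M : 'M[R]_2) hf (1 : R)).
  rewrite addr0 in H; apply: near_eq_is_derive H.
  by apply: filterS near_half01 => s _; rewrite !fctE /= subrK.
apply: (@sym_part_derive_congr _ (conti_gradient j) (conti_Uj n ^~ j) hf _ _ _ _ dG dU).
- by apply/eqP; rewrite -subr_eq0 A0.
- exact: conti_Uj_half.
- by apply: filterS near_half01 => s s01; exact: conti_gradient_cauchy_green.
Qed.

Lemma v0_conti_displacement : linear_conti_displacement n hf v0.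
Proof.
have cv := v0_continuous.
have adm : admissible n hf := nbhs_singleton (admissible_near hn).
split=> //; last first.
  by move=> j jn; exists (displacement_gradient j); exact: v0_gradient_triangle.
split.
- rewrite /conti_pieces finite_setU; split; first by rewrite finite_setU; split; exact: finite_set1.
  apply: finite_image; apply: (@sub_finite_set _ _ `I_(2 * n).+1); last exact: finite_II.
  by move=> j /= /andP[_]; rewrite ltnS.
- apply/seteqP; split=> // x _.
  have [xo|xi|[j jn xj]] := conti_cover hn adm x.
  + by exists (~` outer_polygon n); [left; left|exact: subset_closure].
  + by exists (inner_polygon n hf); [left; right|exact: subset_closure].
  + have /andP[j0 _] := jn.
    exists (conti_triangle n hf j); first by right; exists j.
    by rewrite conti_triangleE//; exact: closed_triangle_closure.
- move=> A [[->|->]|[j jn <-]].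
  + exists 0, 0; apply: (affine_closure cv) => x /v0_outside ->.
    by rewrite mul0mx addr0.
  + exists (spin), 0; apply: (affine_closure cv) => x /v0_inside ->.
    by rewrite addr0.
  + exists (displacement_gradient j), (- (displacement_gradient j *m outer_vertex n j.+1./2)).
    have /andP[j0 _] := jn; rewrite conti_triangleE//.
    apply: (affine_closure cv) => x /open_triangle_closed.
    exact: v0_triangle.
Qed.

End Linearisation.

Theorem proposition3p2 (R : realType) (n : nat) (hn : (3 <= n)%N)
    (u : R -> 'cV[R]_2 -> 'cV[R]_2)
    (hu : forall alpha : R, 0 < alpha < 1 ->
            nonlinear_conti n alpha (u alpha)) :
  let alpha0 : R := 2^-1 in
  let v0 : 'cV[R]_2 -> 'cV[R]_2 :=
    fun x => derive1 (fun alpha => u alpha x) alpha0 in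
  (forall x, derivable (fun alpha => u alpha x) alpha0 1) /\
  linear_conti_displacement n alpha0 v0 /\
  (forall j, (1 <= j <= 2 * n)%N ->
     derivable (fun alpha : R => sym_part (conti_Uj n alpha j)) alpha0 1 /\
     forall x, conti_triangle n alpha0 j x ->
       sym_part (grad v0 x) = linearized_strain n j) /\
  (exists2 W : 'M[R]_2, skew_mx W & gradient_on (~` outer_polygon n) v0 W) /\
  (exists2 W : 'M[R]_2, skew_mx W & gradient_on (inner_polygon n alpha0)° v0 W).
Proof.
move=> alpha0 v0; split; first by move=> x; exact: (@u_derivable _ _ hn _ hu x).
split; first exact: (v0_conti_displacement hn hu).
split.
  move=> j jn; split.
    by apply: derivable_sym_part; exact: derivable_conti_Uj.
  by move=> x /(v0_gradient_triangle hn hu jn)[_ ->]; exact: (displacement_strain hn hu jn).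
split.
  exists 0; first by rewrite /skew_mx trmx0 oppr0.
  apply: (gradient_on_affine (b := 0)); first exact: open_outside.
  by move=> x xo; rewrite mul0mx addr0; exact: (v0_outside hn hu xo).
exists (@spin R n); first exact: skew_spin.
apply: (gradient_on_affine (b := 0)); first exact: open_interior.
by move=> x /interior_subset xi; rewrite addr0; exact: (v0_inside hn hu xi).
Qed.
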